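(* Let $(N,g,\nabla)$ be a Weyl manifold of dimension $n\ge3$ with $H^1(N;\mathbb R)=0$, and let $R=R(\nabla)$. (1) If the Higa term of the curvature vanishes, $H(R)=0$, then the Weyl manifold is trivial. (2) If $\nabla$ is projectively flat, then $R=\pi_1(R)$, where $\pi_1(R)=-\frac{1}{n(n-1)}\tau_g\,g\wedge g$, i.e. $R$ is of constant curvature type; in particular $(N,g,\nabla)$ is Einstein-Weyl. Moreover $\Lambda\operatorname{Ric}=0$, and thus $(N,g,\nabla)$ is trivial.
   Context: A Weyl manifold is a triple $(N,g,\nabla)$ with $g$ a semi-Riemannian metric and $\nabla$ a torsion free connection on $TN$ such that $\nabla g=-2\phi\otimes g$ for some smooth $1$-form $\phi$. When $H^1(N;\mathbb R)=0$ it is called trivial if the following equivalent conditions hold: $d\phi=0$; $\nabla$ is the Levi-Civita connection of some metric in the conformal class of $g$. $\mathcal R(x,y)z:=(\nabla_x\nabla_y-\nabla_y\nabla_x-\nabla_{[x,y]})z$, $R(x,y,z,w):=g(\mathcal R(x,y)z,w)$, $\operatorname{Ric}(x,y):=g^{ij}R(e_i,x,y,e_j)$, $\tau_g:=g^{ij}\operatorname{Ric}(e_i,e_j)$. $S$ and $\Lambda$ denote symmetrization and anti-symmetrization of $(0,2)$-tensors. $(N,g,\nabla)$ is Einstein-Weyl if $S\operatorname{Ric}=\lambda g$ for some function $\lambda$. For bilinear forms: $(\theta_1\cdot\theta_2)(x,y,z,w):=\theta_1(x,y)\theta_2(z,w)$, and for an integer $r$, $(\theta_1\wedge_r\theta_2)(x,y,z,w):=\theta_1(x,z)\theta_2(y,w)-\theta_1(y,z)\theta_2(x,w)-r[\theta_1(x,w)\theta_2(y,z)-\theta_1(y,w)\theta_2(x,z)]$,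 $\wedge:=\wedge_0$. The Higa term is the component $H(R)$ of $R$ in $\mathfrak P$ with respect to the decomposition $\mathfrak W=\mathfrak A\oplus\mathfrak P$ at each point, where $\mathfrak W$ is the space of tensors $A\in\otimes^4T_P^*N$ that are skew in the first two arguments, satisfy $A(x,y,z,w)+A(y,z,x,w)+A(z,x,y,w)=0$, and satisfy $A(x,y,z,w)+A(x,y,w,z)=-\frac4n(\Lambda\operatorname{Ric}(A))(x,y)g(z,w)$ with $\operatorname{Ric}(A)(x,y)=g^{ij}A(e_i,x,y,e_j)$; $\mathfrak A\subset\mathfrak W$ is the subspace with $A(x,y,z,w)+A(x,y,w,z)=0$; and $\mathfrak P=\{2\varphi\cdot g+\varphi\wedge_1 g:\varphi\in\Lambda^2T_P^*N\}$. Explicitly $H(R)=-\frac1n(2\Lambda\operatorname{Ric}\cdot g+\Lambda\operatorname{Ric}\wedge_1 g)$. The connection $\nabla$ is projectively flat if its projective curvature tensor $p(R)=R+\frac{1}{n+1}[2\Lambda\operatorname{Ric}\cdot g+\Lambda\operatorname{Ric}\wedge g]+\frac{1}{n-1}(S\operatorname{Ric})\wedge g$ vanishes identically. *)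

(* Defs.v *)
From HB Require Import structures.
From mathcomp Require Import all_boot all_order all_algebra.
From mathcomp Require Import all_classical all_reals all_analysis.

Set Implicit Arguments.
Unset Strict Implicit.
Unset Printing Implicit Defensive.

Import Order.TTheory GRing.Theory Num.Theory.
Import numFieldNormedType.Exports.

Local Open Scope classical_set_scope.
Local Open Scope ring_scope.

Section PointwiseTensors.
Variables (R : realType) (n : nat).
Local Notation V := 'rV[R]_n.

Definition tensor2 := V -> V -> R.
Definition tensor4 := V -> V -> V -> V -> R.

Definition linear_form (f : V -> R) : Prop :=
  forall (a : R) (x y : V), f (a *: x + y) = a * f x + f y.

Definition bilinear2 (t : tensor2) : Prop :=
  (forall y, linear_form (t^~ y)) /\ (forall x, linear_form (t x)).

Definition multilinear4 (A : tensor4) : Prop :=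
  [/\ forall y z w, linear_form (fun x => A x y z w),
      forall x z w, linear_form (fun y => A x y z w),
      forall x y w, linear_form (fun z => A x y z w)
    & forall x y z, linear_form (A x y z)].

Definition basis_vec (i : 'I_n) : V := delta_mx 0 i.

Definition gram (g : tensor2) : 'M[R]_n :=
  \matrix_(i, j) g (basis_vec i) (basis_vec j).

Definition ginv (g : tensor2) (i j : 'I_n) : R := invmx (gram g) i j.

Definition ricci (g : tensor2) (A : tensor4) : tensor2 := fun x y =>
  \sum_(i < n) \sum_(j < n) ginv g i j * A (basis_vec i) x y (basis_vec j).

Definition metric_trace (g t : tensor2) : R :=
  \sum_(i < n) \sum_(j < n) ginv g i j * t (basis_vec i) (basis_vec j).

Definition symm (t : tensor2) : tensor2 := fun x y => (t x y + t y x) / 2%:R.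
Definition asymm (t : tensor2) : tensor2 := fun x y => (t x y - t y x) / 2%:R.

Definition tdot (s t : tensor2) : tensor4 := fun x y z w => s x y * t z w.

Definition wedge_ (r : int) (s t : tensor2) : tensor4 := fun x y z w =>
  s x z * t y w - s y z * t x w - r%:~R * (s x w * t y z - s y w * t x z).

Definition wedge : tensor2 -> tensor2 -> tensor4 := wedge_ 0.

Definition W_space (g : tensor2) : set tensor4 := [set A |
  [/\ multilinear4 A,
      forall x y z w, A x y z w = - A y x z w,
      forall x y z w, A x y z w + A y z x w + A z x y w = 0
    & forall x y z w, A x y z w + A x y w z =
        - (4%:R / n%:R) * asymm (ricci g A) x y * g z w]].

Definition A_space (g : tensor2) : set tensor4 := [set A |
  W_space g A /\ forall x y z w, A x y z w + A x y w z = 0].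

Definition P_space (g : tensor2) : set tensor4 := [set A |
  exists psi : tensor2,
    [/\ bilinear2 psi, forall x y, psi x y = - psi y x
      & forall x y z w,
          A x y z w = 2%:R * tdot psi g x y z w + wedge_ 1 psi g x y z w]].

(* The component in P_space of A with respect to W_space = A_space (+) P_space;
   the default value is only used when A is not in W_space. *)
Definition higa_component (g : tensor2) (A : tensor4) : tensor4 :=
  xget (fun _ _ _ _ => 0)
    [set B : tensor4 | P_space g B /\
       A_space g (fun x y z w => A x y z w - B x y z w)].

Definition projective_curvature (g : tensor2) (A : tensor4) : tensor4 :=
  fun x y z w =>
    let L := asymm (ricci g A) in
    A x y z w
    + (n%:R + 1)^-1 * (2%:R * tdot L g x y z w + wedge L g x y z w)
    + (n%:R - 1)^-1 * wedge (symm (ricci g A)) g x y z w.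

Definition pi1 (g : tensor2) (A : tensor4) : tensor4 := fun x y z w =>
  - ((n%:R * (n%:R - 1))^-1 * metric_trace g (ricci g A)) * wedge g g x y z w.

End PointwiseTensors.

Section Smooth.
Variables (R : realType) (n : nat).
Local Notation V := 'rV[R]_n.

Fixpoint Ck_on (k : nat) (U : set V) (f : V -> R) : Prop :=
  (forall x, U x -> {for x, continuous f}) /\
  if k is k'.+1 then
    forall i : 'I_n, (forall x, U x -> derivable f x (basis_vec R i)) /\
                     Ck_on k' U ('D_(basis_vec R i) f)
  else True.

Definition smooth_near (x : V) (f : V -> R) : Prop :=
  exists2 U : set V, open_nbhs x U & forall k, Ck_on k U f.

End Smooth.

(* The atlas is indexed by the points: [chart p] is a coordinate system around
   p, with domain [cdom p] and inverse [ichart p].  Away from [cdom p] and from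
   its image these total functions are irrelevant. *)
Record manifold (R : realType) (n : nat) (N : topologicalType) := Manifold {
  cdom : N -> set N;
  chart : N -> N -> 'rV[R]_n;
  ichart : N -> 'rV[R]_n -> N;
  manifold_hausdorff : hausdorff_space N;
  manifold_second_countable : @second_countable N;
  cdom_open : forall p, open (cdom p);
  cdom_refl : forall p, cdom p p;
  cimg_open : forall p, open (chart p @` cdom p);
  chartK : forall p q, cdom p q -> ichart p (chart p q) = q;
  chart_continuous : forall p q, cdom p q -> {for q, continuous (chart p)};
  ichart_continuous :
    forall p q, cdom p q -> {for chart p q, continuous (ichart p)};
  transition_smooth : forall p q s, cdom p s -> cdom q s ->
    forall j : 'I_n,
      smooth_near (chart p s) (fun x => chart q (ichart p x) 0 j)
}.

Section Manifold.
Variables (R : realType) (n : nat) (N : topologicalType).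
Variable M : manifold R n N.
Local Notation V := 'rV[R]_n.

Definition smooth_at (p : N) (f : N -> R) : Prop :=
  smooth_near (chart M p p) (f \o ichart M p).

(* The tangent space at p is identified with R^n by means of the coordinate
   basis of [chart M p]; [dirder p v f] is the derivative v(f) of f along the
   tangent vector v at p. *)
Definition dirder (p : N) (v : V) (f : N -> R) : R :=
  'D_v (f \o ichart M p) (chart M p p).

Definition coord (p : N) (j : 'I_n) : N -> R := fun q => chart M p q 0 j.

(* A vector field is a function X : N -> V with X q tangent at q, hence
   expressed in the coordinate basis of [chart M q]; [vf_comp p X j] is its
   j-th component in the fixed chart around p. *)
Definition vf_comp (p : N) (X : N -> V) (j : 'I_n) : N -> R :=
  fun q => dirder q (X q) (coord p j).

Definition smooth_vf_at (p : N) (X : N -> V) : Prop :=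
  forall j, smooth_at p (vf_comp p X j).

(* The field with constant components v in the chart around p. *)
Definition const_field (p : N) (v : V) : N -> V := fun q =>
  \row_j 'D_v (coord q j \o ichart M p) (chart M p q).

(* [X, Y](x_j) = X(Y(x_j)) - Y(X(x_j)) for the coordinates x_j around p. *)
Definition bracket (X Y : N -> V) : N -> V := fun p =>
  \row_j (dirder p (X p) (vf_comp p Y j) - dirder p (Y p) (vf_comp p X j)).

Record metric := Metric {
  mform :> N -> tensor2 R n;
  metric_bilinear : forall p, bilinear2 (mform p);
  metric_sym : forall p x y, mform p x y = mform p y x;
  metric_nondegenerate :
    forall p x, (forall y, mform p x y = 0) -> x = 0;
  metric_smooth : forall p X Y, smooth_vf_at p X -> smooth_vf_at p Y ->
    smooth_at p (fun q => mform q (X q) (Y q))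
}.

Record one_form := OneForm {
  oform :> N -> V -> R;
  one_form_linear : forall p, linear_form (oform p);
  one_form_smooth : forall p X, smooth_vf_at p X ->
    smooth_at p (fun q => oform q (X q))
}.

Definition ext_der (phi : one_form) (X Y : N -> V) (p : N) : R :=
  dirder p (X p) (fun q => phi q (Y q))
  - dirder p (Y p) (fun q => phi q (X q))
  - phi p (bracket X Y p).

Definition closed_form (phi : one_form) : Prop :=
  forall p X Y, smooth_vf_at p X -> smooth_vf_at p Y -> ext_der phi X Y p = 0.

Definition exact_form (phi : one_form) : Prop :=
  exists2 f : N -> R, (forall p, smooth_at p f)
                    & forall p v, phi p v = dirder p v f.

(* Vanishing of the first de Rham cohomology group, closed forms modulo exact
   forms. *)
Definition H1_vanishes : Prop :=
  forall phi : one_form, closed_form phi -> exact_form phi.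

(* [conn Y p v] is the covariant derivative of Y at p along v.  The axioms only
   concern fields and functions smooth near the point; since f may be the
   indicator function of a neighbourhood of p, the Leibniz rule makes
   [conn Y p v] depend only on the germ of Y at p. *)
Record connection := Connection {
  conn :> (N -> V) -> N -> V -> V;
  conn_linear : forall Y p, smooth_vf_at p Y ->
    forall (a : R) v w, conn Y p (a *: v + w) = a *: conn Y p v + conn Y p w;
  conn_add : forall Y Z p v, smooth_vf_at p Y -> smooth_vf_at p Z ->
    conn (fun q => Y q + Z q) p v = conn Y p v + conn Z p v;
  conn_leibniz : forall (f : N -> R) Y p v, smooth_at p f -> smooth_vf_at p Y ->
    conn (fun q => f q *: Y q) p v = dirder p v f *: Y p + f p *: conn Y p v;
  conn_smooth : forall X Y p, smooth_vf_at p X -> smooth_vf_at p Y ->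
    smooth_vf_at p (fun q => conn Y q (X q))
}.

Definition nabla (D : connection) (X Y : N -> V) : N -> V :=
  fun q => D Y q (X q).

Definition torsion_free (D : connection) : Prop :=
  forall p X Y, smooth_vf_at p X -> smooth_vf_at p Y ->
    nabla D X Y p - nabla D Y X p = bracket X Y p.

Definition nabla_metric (D : connection) (g : metric) (X Y Z : N -> V) (p : N)
    : R :=
  dirder p (X p) (fun q => g q (Y q) (Z q))
  - g p (nabla D X Y p) (Z p) - g p (Y p) (nabla D X Z p).

Definition levi_civita (g : metric) (D : connection) : Prop :=
  torsion_free D /\
  forall p X Y Z, smooth_vf_at p X -> smooth_vf_at p Y -> smooth_vf_at p Z ->
    nabla_metric D g X Y Z p = 0.

Definition weyl_form (g : metric) (D : connection) (phi : one_form) : Prop :=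
  forall p X Y Z, smooth_vf_at p X -> smooth_vf_at p Y -> smooth_vf_at p Z ->
    nabla_metric D g X Y Z p = - 2%:R * phi p (X p) * g p (Y p) (Z p).

Definition weyl (g : metric) (D : connection) : Prop :=
  torsion_free D /\ exists phi : one_form, weyl_form g D phi.

Definition conformal (g g' : metric) : Prop :=
  exists2 f : N -> R, (forall p, smooth_at p f)
    & forall p x y, g' p x y = expR (2%:R * f p) * g p x y.

(* The form phi is determined by g and D.  The two conditions are equivalent
   when H1_vanishes; both are required. *)
Definition weyl_trivial (g : metric) (D : connection) : Prop :=
  (exists2 phi : one_form, weyl_form g D phi & closed_form phi) /\
  (exists2 g' : metric, conformal g g' & levi_civita g' D).

Definition curv_op (D : connection) (X Y Z : N -> V) : N -> V := fun p =>
  nabla D X (nabla D Y Z) p - nabla D Y (nabla D X Z) p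
  - nabla D (bracket X Y) Z p.

(* [curv_op] is tensorial, so its value at p on tangent vectors is computed on
   any smooth extensions, here the constant ones. *)
Definition curvature (g : metric) (D : connection) (p : N) : tensor4 R n :=
  fun x y z w =>
    g p (curv_op D (const_field p x) (const_field p y) (const_field p z) p) w.

Definition Ric (g : metric) (D : connection) (p : N) : tensor2 R n :=
  ricci (g p) (curvature g D p).

Definition higa (g : metric) (D : connection) (p : N) : tensor4 R n :=
  higa_component (g p) (curvature g D p).

Definition einstein_weyl (g : metric) (D : connection) : Prop :=
  exists lambda : N -> R, forall p x y,
    symm (Ric g D p) x y = lambda p * g p x y.

Definition projectively_flat (g : metric) (D : connection) : Prop :=
  forall p x y z w,
    projective_curvature (g p) (curvature g D p) x y z w = 0.

End Manifold.

(* Main.v *)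
Require Import Defs.
From HB Require Import structures.
From mathcomp Require Import all_boot all_order all_algebra.
From mathcomp Require Import all_classical all_reals all_analysis.
From mathcomp Require Import ring lra.

Set Implicit Arguments.
Unset Strict Implicit.
Unset Printing Implicit Defensive.

Import Order.TTheory GRing.Theory Num.Theory.
Import numFieldNormedType.Exports.

Local Open Scope classical_set_scope.
Local Open Scope ring_scope.

(** Write [R] for the curvature, [Lambda] and [S] for the skew and symmetric
    parts of its Ricci tensor, [nabla g = -2 phi (x) g], and evaluate everything
    on the coordinate fields of a chart, whose brackets vanish.

    Second derivatives of the function [g(Z, W)] along two coordinate fields
    commute.  Expanding both orders with the Weyl condition, all terms without
    a second covariant derivative are symmetric except those from the
    derivatives of [phi], and what remains is
      [R(x,y,z,w) + R(x,y,w,z) = 2 dphi(x,y) g(z,w)]   ([curvature_weyl]).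
    Because [nabla] has no torsion, [nabla_Y Z] is symmetric in two coordinate
    fields, which gives the first Bianchi identity ([curvature_bianchi]).
    Contracting these two identities yields [Lambda = -(n/2) dphi]
    ([ricci_skew_part]).  So [R] lies in the space W at each point, and both
    hypotheses become questions of linear algebra at a point.

    (1) Subtracting [2 psi . g + psi wedge_1 g] with [psi = -Lambda/n] from [R]
    leaves a tensor that is skew in the last two arguments, so this is the
    component of [R] in P ([higa_vanishing]).  If it vanishes then [R] is itself
    skew in the last two arguments and [dphi (x) g = 0].

    (2) Symmetrizing [p(R) = 0] in the last two arguments and contracting once
    expresses [S] by [g] and [Lambda].  The skew part of this relation is
    [(4 - n^2) Lambda = 0], the symmetric part is [S = (tau/n) g], and
    substituting both in [p(R) = 0] gives [R = pi_1(R)]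
    ([projectively_flat_algebra]).

    In both cases [dphi = 0] on coordinate fields, hence on all fields since
    [dphi] is tensorial ([ext_der_tensorial]).  As [H^1 = 0], [phi = df], and
    [nabla] is the Levi-Civita connection of [exp(2f) g]
    ([conformal_levi_civita]).

    The analytic input is the chain rule and the symmetry of second
    derivatives for functions given with iterated continuous partial
    derivatives; both come from the mean value theorem.  The chain rule is
    what allows all derivatives at points near [p], each defined in the chart
    attached to that point, to be computed in the one chart around [p]
    ([dirder_chart]). *)

(** * Continuous partial derivatives imply differentiability *)

Section MeanValue.
Variables (R : realType) (n : nat).
Local Notation V := 'rV[R]_n.
Implicit Types (f g : V -> R) (x y v w : V) (U W : set V).

Lemma derivable_line f y v t : derivable f (t *: v + y) v ->
  is_derive t 1 (fun s : R => f (s *: v + y)) ('D_v f (t *: v + y)).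
Proof.
move=> dfv.
have E : (fun h : R => h^-1 *: (((fun s : R => f (s *: v + y)) \o shift t)
  (h *: (1:R)) - f (t *: v + y)))
  = (fun h : R => h^-1 *: ((f \o shift (t *: v + y)) (h *: v) - f (t *: v + y))).
  by apply/funext => h /=; rewrite [h *: 1]mulr1 scalerDl addrA.
by split; [rewrite /derivable E | rewrite /derive E].
Qed.

Lemma is_derive_translate f x v c :
  derivable f (x + c) v -> is_derive x v (fun y => f (y + c)) ('D_v f (x + c)).
Proof.
move=> dfv.
have E : (fun h : R => h^-1 *: (((fun y => f (y + c)) \o shift x) (h *: v)
  - f (x + c)))
   = (fun h => h^-1 *: ((f \o shift (x + c)) (h *: v) - f (x + c))).
  by apply/funext => h /=; rewrite addrA.
by split; [rewrite /derivable E | rewrite /derive E].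
Qed.

(** This is the one-variable theorem for the restriction of [f] to a line; the
    two signs of [a] traverse the segment in opposite directions. *)
Lemma MVT_line f y v (a : R) :
  (forall t, `|t| <= `|a| -> derivable f (t *: v + y) v) ->
  exists2 t, `|t| <= `|a| & f (a *: v + y) - f y = a * 'D_v f (t *: v + y).
Proof.
move=> dfv.
have main b c : b <= c -> (forall t, b <= t <= c -> `|t| <= `|a|) ->
    exists2 t, `|t| <= `|a| &
      f (c *: v + y) - f (b *: v + y) = 'D_v f (t *: v + y) * (c - b).
  move=> bc bca.
  have dg t : b <= t <= c ->
      is_derive t 1 (fun s : R => f (s *: v + y)) ('D_v f (t *: v + y)).
    by move=> tbc; apply/derivable_line/dfv/bca.
  have [|//||t tbc E] := @MVT_segment R (fun s => f (s *: v + y))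
    (fun t => 'D_v f (t *: v + y)) b c.
  - by [].
  - by move=> t; rewrite in_itv /= => /andP[/ltW ? /ltW ?]; apply: dg; apply/andP.
  - apply: derivable_within_continuous => t; rewrite in_itv /= => tbc.
    by have [] := dg _ tbc.
  - exists t; last by rewrite E.
    by apply: bca; move: tbc; rewrite in_itv.
have [a0|/ltW a0] := leP 0 a.
  have [||t ta E] := main 0 a => //.
    by move=> t /andP[t0 ta]; rewrite !ger0_norm.
  by exists t => //; move: E; rewrite scale0r add0r subr0 mulrC.
have [||t ta E] := main a 0 => //.
  by move=> t /andP[t0 ta]; rewrite !ler0_norm // lerN2.
exists t => //; apply/eqP; rewrite -eqr_opp opprB; move: E.
by rewrite scale0r add0r sub0r mulrN mulrC => ->.
Qed.

(** As [m] runs from [0] to [n] these vectors lead from [0] to [h] by moves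
    parallel to the coordinate axes, along which only partial derivatives are
    needed. *)
Definition first_coords (m : nat) (h : V) : V :=
  \row_i (if (i < m)%N then h 0 i else 0).

Lemma first_coords0 h : first_coords 0 h = 0.
Proof. by apply/rowP => i; rewrite !mxE ltn0. Qed.

Lemma first_coordsn h : first_coords n h = h.
Proof. by apply/rowP => i; rewrite !mxE ltn_ord. Qed.

Lemma first_coordsS h (i : 'I_n) :
  first_coords i.+1 h = h 0 i *: basis_vec R i + first_coords i h.
Proof.
apply/rowP => j; rewrite !mxE eqxx /= ltnS leq_eqVlt.
have [/val_inj ->|ij] := eqVneq (val j) (val i).
  by rewrite ltnn eqxx addr0 mulr1.
by rewrite (_ : (j == i) = false) ?mulr0 ?add0r //; apply/negbTE.
Qed.

Lemma coord_le_norm v (i : 'I_n) : `|v 0 i| <= `|v|.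
Proof. by rewrite [leRHS]/Num.Def.normr/= mx_normrE;
  exact: (le_bigmax _ _ (0, i)). Qed.

Lemma norm_le_coord v (e : R) : 0 <= e -> (forall i, `|v 0 i| <= e) -> `|v| <= e.
Proof.
move=> e0 ve; rewrite /Num.Def.normr/= mx_normrE (bigmax_le _ e0) //= =>
  -[i j] _ /=.
by rewrite ord1.
Qed.

Lemma row_sum_basis v : v = \sum_i v 0 i *: basis_vec R i.
Proof. exact: row_sum_delta. Qed.

(** On the path through the [first_coords m h], the [i]-th step changes [f] by
    [h_i] times a partial derivative at some point no farther from [x] than
    [h]; by continuity this is close to the partial derivative at [x]. *)
Lemma C1_estimate f x :
  (forall i, \forall y \near x, derivable f y (basis_vec R i)) ->
  (forall i, {for x, continuous ('D_(basis_vec R i) f)}) ->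
  forall e : R, 0 < e -> \forall h \near (0 : V),
    `|f (h + x) - f x - \sum_i h 0 i * 'D_(basis_vec R i) f x| <= e * `|h|.
Proof.
move=> df cf e e0.
(* Each of the [n] steps contributes an error of at most [e' * `|h|]; dividing
   by [n.+1] also makes sense for [n = 0]. *)
pose e' := e / n.+1%:R; have e'0 : 0 < e' by rewrite divr_gt0.
have : \forall y \near x, forall i, derivable f y (basis_vec R i) /\
    `|'D_(basis_vec R i) f x - 'D_(basis_vec R i) f y| <= e'.
  apply: (@filter_forall V 'I_n (fun i y => derivable f y (basis_vec R i) /\
    `|'D_(basis_vec R i) f x - 'D_(basis_vec R i) f y| <= e') (nbhs x)) => i.
  have h2 : \forall y \near x,
      `|'D_(basis_vec R i) f x - 'D_(basis_vec R i) f y| <= e'.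
    by move/cvgrPdist_le : (cf i) => /(_ _ e'0).
  by apply: filterS2 (df i) h2.
move=> /nbhs_ballP [d /= d0 dP].
apply/nbhs_ballP; exists d => //= h; rewrite -ball_normE /= sub0r normrN => hd.
have step (m : nat) : (m <= n)%N ->
  `|f (first_coords m h + x) - f x
     - \sum_(i < n | (i < m)%N) h 0 i * 'D_(basis_vec R i) f x|
    <= m%:R * (e' * `|h|).
  elim: m => [|m IH] mn.
    by rewrite first_coords0 add0r subrr big1 ?subrr ?normr0 ?mul0r // => i;
      rewrite ltn0.
  pose i := Ordinal mn.
  have inb t : `|t| <= `|h 0 i| ->
      ball x d (t *: basis_vec R i + (first_coords i h + x)).
    move=> th; rewrite -ball_normE /= addrA opprD addrCA subrr addr0 normrN.
    apply: le_lt_trans hd; apply: norm_le_coord => // j; rewrite !mxE eqxx /=.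
    have [->|ji] := eqVneq j i.
      by rewrite ltnn addr0 mulr1 (le_trans th) ?coord_le_norm.
    by rewrite mulr0 add0r; case: ifP => _; rewrite ?normr0 // coord_le_norm.
  have [t th|t th E] := @MVT_line f (first_coords i h + x) (basis_vec R i) (h 0 i).
    by have [] := dP _ (inb _ th) i.
  rewrite (bigD1 i) //= (eq_bigl (fun j : 'I_n => (j < m)%N)); last first.
    move=> j; rewrite ltnS leq_eqVlt -val_eqE /=.
    by case: (ltngtP j m) => // ->; rewrite andbF.
  rewrite (first_coordsS h i) -[_ + _ + x]addrA.
  have -> : f (h 0 i *: basis_vec R i + (first_coords i h + x)) =
     f (first_coords i h + x)
     + h 0 i * 'D_(basis_vec R i) f (t *: basis_vec R i + (first_coords i h + x)).
    by rewrite -E [RHS]addrC subrK.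
  set Dt := 'D_(basis_vec R i) f (t *: _ + _); set S := \sum_(_ < n | _) _.
  have -> : f (first_coords i h + x) + h 0 i * Dt - f x
       - (h 0 i * 'D_(basis_vec R i) f x + S)
     = (f (first_coords i h + x) - f x - S)
       + h 0 i * (Dt - 'D_(basis_vec R i) f x) by ring.
  apply: le_trans (ler_normD _ _) _; rewrite -[m.+1]addn1 natrD mulrDl mul1r.
  apply: lerD; first exact/IH/ltnW.
  rewrite normrM mulrC; apply: ler_pM => //; last exact: coord_le_norm.
  by rewrite distrC; have [] := dP _ (inb _ th) i.
have := step n (leqnn n); rewrite first_coordsn.
have -> F : \sum_(i < n | (i < n)%N) F i = \sum_i F i :> R.
  by apply: eq_bigl => i; rewrite ltn_ord.
move=> /le_trans; apply; rewrite mulrA; apply: ler_wpM2r => //.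
rewrite /e' mulrCA -[leRHS]mulr1; apply: ler_wpM2l; first exact: ltW.
by rewrite ler_pdivrMr // mul1r ler_nat.
Qed.

Lemma C1_differentiable f x :
  (forall i, \forall y \near x, derivable f y (basis_vec R i)) ->
  (forall i, {for x, continuous ('D_(basis_vec R i) f)}) ->
  differentiable f x.
Proof.
move=> df cf.
pose L (h : V) : R := \sum_i h 0 i * 'D_(basis_vec R i) f x.
have Llin : linear L.
  move=> a u v; rewrite /L scaler_sumr -big_split; apply: eq_bigr => i _ /=.
  by rewrite !mxE mulrDl -mulrA.
pose LM := GRing.isLinear.Build _ _ _ _ _ Llin.
pose Lf : {linear V -> R} := HB.pack L LM.
have Lc : continuous Lf.
  have -> : Lf = \sum_i (fun h : V => h 0 i *: 'D_(basis_vec R i) f x)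
      :> (V -> R).
    by apply/funext => h; rewrite fct_sumE.
  move=> h; apply/differentiable_continuous/differentiable_sum => i.
  exact/differentiableZl/differentiable_coord.
have lo : forall e : R, 0 < e -> \forall h \near (0 : V),
    `|((f \o shift x) - (cst (f x) + Lf)) h| <= e * `|h|.
  move=> e e0; have := C1_estimate df cf e0.
  by apply: filterS => h /=; rewrite opprD addrA.
have dE : 'd f x = Lf :> (V -> R).
  by apply: (diff_unique Lc); apply/eqaddoP.
apply/diff_locallyP; rewrite dE; split=> //.
by apply/eqaddoP.
Qed.

End MeanValue.

Local Opaque derive derivable.

(** * Symmetry of second derivatives *)

Section MixedPartials.
Variables (R : realType) (n : nat).
Local Notation V := 'rV[R]_n.
Implicit Types (f g : V -> R) (x y v w : V) (U W : set V) (k : nat).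

(** The mean value theorem is used twice: along [v] for the function
    [y |-> f (y + t w) - f y], then along [w] for the derivative of [f] along
    [v]. *)
Lemma second_difference f x v w (s t : R) :
  (forall a b : R, `|a| <= `|s| -> `|b| <= `|t| ->
     derivable f (a *: v + b *: w + x) v /\
     derivable ('D_v f) (a *: v + b *: w + x) w) ->
  exists a b : R, [/\ `|a| <= `|s|, `|b| <= `|t| &
   f (s *: v + t *: w + x) - f (s *: v + x) - f (t *: w + x) + f x =
   s * t * 'D_w ('D_v f) (a *: v + b *: w + x)].
Proof.
move=> df.
have d0 a : `|a| <= `|s| -> derivable f (a *: v + x) v.
  move=> ha; have := df a 0 ha; rewrite normr0 scale0r addr0.
  by move=> /(_ (normr_ge0 t)) -[h _]; exact: h.
have dt a : `|a| <= `|s| -> derivable f (a *: v + x + t *: w) v.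
  by move=> ha; have [h _] := df a t ha (lexx _); rewrite addrAC; exact: h.
have dphi a : `|a| <= `|s| ->
    is_derive (a *: v + x) v (fun y => f (y + t *: w) - f y)
      ('D_v f (a *: v + x + t *: w) - 'D_v f (a *: v + x)).
  move=> ha; have h1 := is_derive_translate (dt a ha).
  by have h2 := derivableP (d0 a ha); apply: is_deriveB.
have [|a sa Ea] := @MVT_line R n (fun y => f (y + t *: w) - f y) x v s.
  by move=> a /dphi [].
have [|b tb Eb] := @MVT_line R n ('D_v f) (a *: v + x) w t.
  by move=> b tb; have [_] := df _ _ sa tb; rewrite -addrA addrCA.
exists a, b; split; [exact: sa|exact: tb|].
have [_ Da] := dphi a sa; rewrite Da in Ea.
have -> : a *: v + b *: w + x = b *: w + (a *: v + x)
  by rewrite addrA [b *: w + _]addrC.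
rewrite -mulrA -Eb [t *: w + (_ + _)]addrC -Ea [s *: v + t *: w + x]addrAC.
rewrite [t *: w + x]addrC opprB -[LHS]addrA.
by rewrite [- f _ + _]addrC.
Qed.

(** The second difference does not change when [v] and [w] are exchanged, so
    [second_difference] yields points arbitrarily close to [x] at which one mixed
    derivative equals the value of the other at a second such point.  Continuity
    at [x] finishes the proof. *)
Lemma schwarz U f x v w : open U -> U x ->
  (forall y, U y -> [/\ derivable f y v, derivable ('D_v f) y w,
                        derivable f y w & derivable ('D_w f) y v]) ->
  {for x, continuous ('D_w ('D_v f))} -> {for x, continuous ('D_v ('D_w f))} ->
  'D_w ('D_v f) x = 'D_v ('D_w f) x.
Proof.
move=> oU Ux dU cwv cvw; apply/eqP; rewrite -subr_eq0 -normr_eq0 eq_le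
  normr_ge0 andbT.
apply/ler_addgt0Pl => e e0; rewrite addr0.
have e20 : 0 < e / 2 by rewrite divr_gt0.
have : \forall y \near x, [/\ U y,
  `|'D_w ('D_v f) x - 'D_w ('D_v f) y| <= e / 2 &
  `|'D_v ('D_w f) x - 'D_v ('D_w f) y| <= e / 2].
  have n1 : \forall y \near x, U y by apply: open_nbhs_nbhs; split.
  have n2 : \forall y \near x, `|'D_w ('D_v f) x - 'D_w ('D_v f) y| <= e / 2.
    by move/cvgrPdist_le : cwv => /(_ _ e20).
  have n3 : \forall y \near x, `|'D_v ('D_w f) x - 'D_v ('D_w f) y| <= e / 2.
    by move/cvgrPdist_le : cvw => /(_ _ e20).
  exact: filterS3 n1 n2 n3.
move=> /nbhs_ballP [d /= d0 dP].
(* The summand [1] covers the case where [v] and [w] are both zero. *)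
pose s := d / (2 * (`|v| + `|w| + 1)).
have N0 : 0 < `|v| + `|w| + 1 by rewrite ltr_wpDl // addr_ge0.
have s0 : 0 < s by rewrite divr_gt0 // mulr_gt0.
have sN : s * (`|v| + `|w|) < d.
  rewrite /s -mulrA gtr_pMr // ltr_pdivrMl ?mulr_gt0 // mulr1.
  have : 0 <= `|v| + `|w| by rewrite addr_ge0.
  set N := `|v| + `|w|; lra.
have inb a b : `|a| <= `|s| -> `|b| <= `|s| -> ball x d (a *: v + b *: w + x).
  rewrite (gtr0_norm s0) => sa sb.
  rewrite -ball_normE /= opprD addrCA subrr addr0 normrN.
  apply: le_lt_trans sN; rewrite mulrDr (le_trans (ler_normD _ _)) //.
  by rewrite !normrZ lerD // ler_wpM2r.
have [|a [b [sa sb E1]]] := @second_difference f x v w s s.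
  move=> a b sa sb; have [/dU[h1 h2 _ _] _ _] := dP _ (inb a b sa sb).
  exact: (conj h1 h2).
have [|a' [b' [sa' sb' E2]]] := @second_difference f x w v s s.
  move=> a' b' sa' sb'; rewrite [a' *: _ + _]addrC.
  have [/dU[_ _ h1 h2] _ _] := dP _ (inb b' a' sb' sa').
  exact: (conj h1 h2).
have Ediff : f (s *: v + s *: w + x) - f (s *: v + x) - f (s *: w + x) + f x =
    f (s *: w + s *: v + x) - f (s *: w + x) - f (s *: v + x) + f x.
  by rewrite [s *: w + s *: v]addrC; congr (_ + _); exact: addrAC.
have E : 'D_w ('D_v f) (a *: v + b *: w + x) = 'D_v ('D_w f)
  (a' *: w + b' *: v + x).
  have ss0 : s * s != 0 by rewrite mulf_neq0 // gt_eqF.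
  exact: (mulfI ss0 (etrans (esym E1) (etrans Ediff E2))).
have [_ h1 _] := dP _ (inb a b sa sb); have [_ _] := dP _ (inb b' a' sb' sa').
rewrite [b' *: v + _]addrC => h2; rewrite E distrC in h1.
rewrite distrC (splitr e).
apply: le_trans (lerD h2 h1); apply: le_trans (ler_normD _ _); rewrite subrKA.
exact: lexx.
Qed.

End MixedPartials.

(** * Calculus of smooth functions on open sets of a coordinate space *)

Section Smoothness.
Variables (R : realType) (n : nat).
Local Notation V := 'rV[R]_n.
Implicit Types (f g : V -> R) (x y v w : V) (U W : set V) (k : nat).

Lemma Ck_on_continuous k U f x : Ck_on k U f -> U x -> {for x, continuous f}.
Proof. by case: k => [|k] [+ _]; apply. Qed.

Lemma Ck_onW k U f : Ck_on k.+1 U f -> Ck_on k U f.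
Proof.
elim: k f => [|k IH] f [cf df]; first by split.
by split=> // i; have [d1 d2] := df i; split=> //; apply: IH.
Qed.

Lemma Ck_on_subset k U W f : W `<=` U -> Ck_on k U f -> Ck_on k W f.
Proof.
move=> WU; elim: k f => [|k IH] f [cf df]; split=> //; try by move=> x /WU /cf.
by move=> i; have [d1 d2] := df i; split; [move=> x /WU; exact: d1|exact: IH].
Qed.

Lemma near_eq_continuous f g x : {near x, f =1 g} -> {for x, continuous f} ->
  {for x, continuous g}.
Proof.
move=> fg; rewrite /prop_for /continuous_at -(nbhs_singleton fg) => cf.
exact: cvg_trans (near_eq_cvg fg) cf.
Qed.

(** The differentiation rules below hold only at points of [U], while
    [Ck_on] speaks of derivatives as functions on the whole space; this lemma
    lets such a rule replace one function by another inside [Ck_on]. *)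
Lemma Ck_on_eq k U f g : open U -> (forall x, U x -> f x = g x) ->
  Ck_on k U f -> Ck_on k U g.
Proof.
move=> oU; elim: k f g => [|k IH] f g fg [cf df].
  split=> // x Ux; apply: near_eq_continuous (cf x Ux).
  by apply: filterS fg _; apply: open_nbhs_nbhs.
have nfg x : U x -> {near x, f =1 g}.
  by move=> Ux; apply: filterS fg _; apply: open_nbhs_nbhs.
split=> [x Ux|i]; first exact: near_eq_continuous (nfg x Ux) (cf x Ux).
have [d1 d2] := df i; split.
  by move=> x Ux; exact: near_eq_derivable (nfg x Ux) (d1 x Ux).
by apply: IH d2 => x Ux; exact: near_eq_derive (nfg x Ux).
Qed.

Lemma Ck_on_differentiable k U f x : open U -> Ck_on k.+1 U f -> U x ->
  differentiable f x.
Proof.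
move=> oU [cf df] Ux; apply: C1_differentiable => i; have [d1 d2] := df i.
  by apply: filterS d1 _; apply: open_nbhs_nbhs.
exact: Ck_on_continuous d2 Ux.
Qed.

Lemma derive_basis f x v : differentiable f x ->
  'D_v f x = \sum_i v 0 i * 'D_(basis_vec R i) f x.
Proof.
move=> df; rewrite deriveE // {1}(row_sum_basis v) linear_sum.
by apply: eq_bigr => i _; rewrite linearZ deriveE.
Qed.

Lemma Ck_on_cst k U (c : R) : Ck_on k U (cst c).
Proof.
elim: k c => [|k IH] c; (split; first by move=> x _; exact: cst_continuous) => //.
move=> i; split; first by move=> x _; exact: derivable_cst.
have -> : 'D_(basis_vec R i) (cst c) = cst 0 :> (V -> R).
  by apply/funext => x; exact: derive_cst.
exact: IH.
Qed.

Lemma Ck_onD k U f g : open U -> Ck_on k U f -> Ck_on k U g ->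
  Ck_on k U (f + g).
Proof.
move=> oU; elim: k f g => [|k IH] f g [cf df] [cg dg].
  by split=> // x Ux; apply: continuousD; [exact: cf|exact: cg].
split=> [x Ux|i]; first by apply: continuousD; [exact: cf|exact: cg].
have [df1 df2] := df i; have [dg1 dg2] := dg i; split.
  by move=> x Ux; apply: derivableD; [exact: df1|exact: dg1].
apply: (@Ck_on_eq k U ('D_(basis_vec R i) f + 'D_(basis_vec R i) g))
  (IH _ _ df2 dg2) => // x Ux.
by rewrite deriveD; [|exact: df1|exact: dg1].
Qed.

Lemma Ck_onM k U f g : open U -> Ck_on k U f -> Ck_on k U g ->
  Ck_on k U (f * g).
Proof.
move=> oU; elim: k f g => [|k IH] f g Cf Cg; have [cf df] := Cf; have [cg dg] := Cg.
  by split=> // x Ux; apply: continuousM; [exact: cf|exact: cg].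
split=> [x Ux|i]; first by apply: continuousM; [exact: cf|exact: cg].
have [df1 df2] := df i; have [dg1 dg2] := dg i; split.
  by move=> x Ux; apply: derivableM; [exact: df1|exact: dg1].
apply: (@Ck_on_eq k U (f * 'D_(basis_vec R i) g + g * 'D_(basis_vec R i) f)) => //.
  by move=> x Ux; rewrite deriveM; [|exact: df1|exact: dg1].
by apply: Ck_onD => //; apply: IH => //; apply: Ck_onW.
Qed.

Lemma Ck_on_sum k U (I : finType) (F : I -> V -> R) : open U ->
  (forall i, Ck_on k U (F i)) -> Ck_on k U (\sum_i F i).
Proof.
move=> oU CF; elim/big_ind: _ => [|f g Cf Cg|i _] //; last exact: Ck_onD.
exact: Ck_on_cst.
Qed.

Lemma Ck_on_derive k U f v : open U -> Ck_on k.+1 U f -> Ck_on k U ('D_v f).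
Proof.
move=> oU Cf.
apply: (@Ck_on_eq k U (\sum_i (cst (v 0 i) * 'D_(basis_vec R i) f))) => //.
  by move=> x Ux; rewrite (derive_basis _ (Ck_on_differentiable oU Cf Ux)) fct_sumE.
apply: Ck_on_sum => // i; apply: Ck_onM => //; first exact: Ck_on_cst.
by have [_ /(_ i)[]] := Cf.
Qed.

End Smoothness.

Section Composition.
Variables (R : realType) (n : nat).
Local Notation V := 'rV[R]_n.
Implicit Types (f g : V -> R) (x y v w : V) (U W : set V) (k : nat).

Lemma continuous_row (h : V -> V) x :
  (forall j, {for x, continuous (fun y => h y 0 j)}) -> {for x, continuous h}.
Proof.
move=> ch; apply/(@cvgrPdist_le _ V V (nbhs x) (nbhs_filter x) h (h x)) => e e0.
have H : \forall y \near x, forall j : 'I_n, `|h x 0 j - h y 0 j| <= e.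
  apply: (@filter_forall V 'I_n (fun j y => `|h x 0 j - h y 0 j| <= e)
    (nbhs x)) => j.
  by move/cvgrPdist_le : (ch j) => /(_ _ e0).
apply: (@filterS _ (nbhs x) _ _ _ _ H) => y hy; apply: norm_le_coord;
  first exact: ltW.
by move=> j; rewrite !mxE; exact: hy.
Qed.

Lemma differentiable_row (h : V -> V) x :
  (forall j, differentiable (fun y => h y 0 j) x) -> differentiable h x.
Proof.
move=> dh; have -> : h = \sum_j (fun y => h y 0 j *: basis_vec R j).
  by apply/funext => y; rewrite fct_sumE -row_sum_basis.
by apply: differentiable_sum => j; exact/differentiableZl/dh.
Qed.

Lemma derive_row (h : V -> V) x v :
  (forall j, differentiable (fun y => h y 0 j) x) ->
  'D_v h x = \row_j 'D_v (fun y => h y 0 j) x.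
Proof.
move=> dh; rewrite derive_mx; last exact/diff_derivable/differentiable_row.
by apply/matrixP => i j; rewrite !mxE ord1.
Qed.

Lemma derive_comp_row (h : V -> V) f x v :
  (forall j, differentiable (fun y => h y 0 j) x) -> differentiable f (h x) ->
  'D_v (f \o h) x = 'D_(\row_j 'D_v (fun y => h y 0 j) x) f (h x).
Proof.
move=> dh df; have dhx := differentiable_row dh.
rewrite -(derive_row v dh) (deriveE _ df) (deriveE _ dhx).
rewrite (deriveE _ (differentiable_comp dhx df)).
exact: (congr1 (@^~ v) (diff_comp dhx df)).
Qed.

(** Induction on [k]: by the chain rule the partial derivatives of the
    composite are sums of products of functions to which the induction
    hypothesis applies. *)
Lemma Ck_on_comp k U W f (h : V -> V) : open U -> open W ->
  (forall x, W x -> U (h x)) -> (forall j, Ck_on k W (fun x => h x 0 j)) ->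
  Ck_on k U f -> Ck_on k W (f \o h).
Proof.
move=> oU oW hWU; elim: k f => [|k IH] f Ch Cf; have [cf df] := Cf.
  split=> // x Wx; apply: continuous_comp; last exact/cf/hWU.
  by apply: continuous_row => j; exact: Ck_on_continuous (Ch j) Wx.
split=> [x Wx|i].
  apply: continuous_comp; last exact/cf/hWU.
  by apply: continuous_row => j; exact: Ck_on_continuous (Ch j) Wx.
have dh x : W x -> forall j, differentiable (fun y => h y 0 j) x.
  by move=> Wx j; exact: Ck_on_differentiable (Ch j) Wx.
have dfh x : W x -> differentiable f (h x).
  by move=> /hWU; exact: Ck_on_differentiable Cf.
split=> [x Wx|].
  apply/diff_derivable/differentiable_comp; last exact: dfh.
  exact/differentiable_row/dh.
apply: (@Ck_on_eq _ _ k W (\sum_j ('D_(basis_vec R i) (fun y => h y 0 j) *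
            ('D_(basis_vec R j) f \o h)))) => //.
  move=> x Wx; rewrite fct_sumE (derive_comp_row _ (dh x Wx) (dfh x Wx)).
  rewrite (derive_basis _ (dfh x Wx)).
  by apply: eq_bigr => j _; rewrite mxE.
apply: Ck_on_sum => // j; apply: Ck_onM => //.
  by have [_ /(_ i)[]] := Ch j.
apply: IH; last by have [_ /(_ j)[]] := Cf.
by move=> l; exact: Ck_onW (Ch l).
Qed.

Lemma differentiable_expR_comp f x : differentiable f x ->
  differentiable (expR \o f) x.
Proof.
move=> df; apply: differentiable_comp => //.
exact/derivable1_diffP/derivable_expR.
Qed.

Lemma derive_expR_comp f x v : differentiable f x ->
  'D_v (expR \o f) x = expR (f x) * 'D_v f x.
Proof.
move=> df; have de : differentiable (@expR R) (f x).
  exact/derivable1_diffP/derivable_expR.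
rewrite (deriveE _ df) (deriveE _ (differentiable_comp df de)).
rewrite (congr1 (@^~ v) (diff_comp df de)) /=.
rewrite deriv1E; last exact: derivable_expR.
by rewrite derive1E (congr1 (@^~ (f x)) (@derive_expR R)) [LHS]mulrC.
Qed.

Lemma Ck_on_expR k U f : open U -> Ck_on k U f -> Ck_on k U (expR \o f).
Proof.
move=> oU; elim: k f => [|k IH] f Cf; have [cf df] := Cf.
  split=> // x Ux; apply: continuous_comp; first exact: cf.
  exact: continuous_expR.
split=> [x Ux|i].
  by apply: continuous_comp; [exact: cf|exact: continuous_expR].
have dfx x : U x -> differentiable f x by exact: Ck_on_differentiable Cf.
split=> [x Ux|]; first exact/diff_derivable/differentiable_expR_comp/dfx.
apply: (@Ck_on_eq _ _ k U ((expR \o f) * 'D_(basis_vec R i) f)) => //.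
  by move=> x Ux; rewrite derive_expR_comp //; exact: dfx.
apply: Ck_onM => //; first exact/IH/Ck_onW.
by have [_ /(_ i)[]] := Cf.
Qed.

End Composition.

Lemma near_open (T : topologicalType) (x : T) (P : T -> Prop) :
  (\forall y \near x, P y) ->
  exists2 B : set T, open_nbhs x B & forall y, B y -> P y.
Proof. by move=> H; have : nbhs x P by []; rewrite nbhsE. Qed.

Section SmoothNear.
Variables (R : realType) (n : nat).
Local Notation V := 'rV[R]_n.
Implicit Types (f g : V -> R) (x y v w : V).

Lemma smooth_near_nbhs x f : smooth_near x f ->
  \forall y \near x, smooth_near y f.
Proof.
move=> [U [oU Ux] CU].
have : \forall y \near x, U y by apply: open_nbhs_nbhs.
by apply: filterS => y Uy; exists U.
Qed.

Lemma smooth_near_eq x f g : (\forall y \near x, f y = g y) ->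
  smooth_near x f -> smooth_near x g.
Proof.
move=> /near_open [W [oW Wx] fgW] [U [oU Ux] CU].
have oUW : open (U `&` W) by apply: openI.
exists (U `&` W); first by [].
move=> k; apply: (@Ck_on_eq _ _ k _ f g oUW); first by move=> y [_ /fgW].
by apply: Ck_on_subset (CU k) => y [].
Qed.

Lemma smooth_near2 (op : (V -> R) -> (V -> R) -> (V -> R)) x f g :
  (forall k U f g, open U -> Ck_on k U f -> Ck_on k U g -> Ck_on k U (op f g)) ->
  smooth_near x f -> smooth_near x g -> smooth_near x (op f g).
Proof.
move=> Cop [U [oU Ux] CU] [W [oW Wx] CW].
have oUW : open (U `&` W) by apply: openI.
exists (U `&` W); first by [].
by move=> k; apply: Cop => //; [apply: Ck_on_subset (CU k)|apply: Ck_on_subset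
  (CW k)] => y [].
Qed.

Lemma smooth_nearD x f g : smooth_near x f -> smooth_near x g ->
  smooth_near x (fun y => f y + g y).
Proof. by apply: (@smooth_near2 (fun f g => f + g)) => *; exact: Ck_onD. Qed.

Lemma smooth_nearM x f g : smooth_near x f -> smooth_near x g ->
  smooth_near x (fun y => f y * g y).
Proof. by apply: (@smooth_near2 (fun f g => f * g)) => *; exact: Ck_onM. Qed.

Lemma smooth_near_cst x (c : R) : smooth_near x (fun=> c).
Proof.
exists setT; first by split; [exact: openT|].
by move=> k; exact: Ck_on_cst.
Qed.

Lemma smooth_near_sum x (I : finType) (F : I -> V -> R) :
  (forall i, smooth_near x (F i)) -> smooth_near x (fun y => \sum_i F i y).
Proof.
move=> sF; have -> : (fun y => \sum_i F i y) = \sum_i F i.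
  by apply/funext => y; rewrite fct_sumE.
elim/big_ind: _ => [|f g|i _]; [exact: smooth_near_cst|exact:
  smooth_nearD|exact: sF].
Qed.

Lemma smooth_near_expR x f : smooth_near x f ->
  smooth_near x (fun y => expR (f y)).
Proof. by move=> [U [oU Ux] CU]; exists U => // k; exact: Ck_on_expR. Qed.

Lemma smooth_near_derive x f v : smooth_near x f -> smooth_near x ('D_v f).
Proof. by move=> [U [oU Ux] CU]; exists U => // k; exact: Ck_on_derive. Qed.

Lemma smooth_near_differentiable x f : smooth_near x f -> differentiable f x.
Proof. by move=> [U [oU Ux] CU]; exact: Ck_on_differentiable oU (CU 1%N) Ux. Qed.

Lemma smooth_near_continuous x f : smooth_near x f -> {for x, continuous f}.
Proof. by move=> /smooth_near_differentiable/differentiable_continuous. Qed.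

Lemma smooth_near_comp x f (h : V -> V) :
  (forall j, smooth_near x (fun y => h y 0 j)) -> smooth_near (h x) f ->
  smooth_near x (f \o h).
Proof.
move=> sh [U [oU Uhx] CU].
have ch : {for x, continuous h}.
  by apply: continuous_row => j; exact/smooth_near_continuous/sh.
have nU : \forall y \near x, U (h y).
  by apply: ch; apply: open_nbhs_nbhs.
have sW j : exists W : set V, open_nbhs x W /\ forall k, Ck_on k W (fun y =>
  h y 0 j).
  by have [W ? ?] := sh j; exists W.
have [W WP] := boolp.choice sW.
have nW : \forall y \near x, forall j, W j y.
  apply: (@filter_forall V 'I_n W (nbhs x)) => j.
  by apply: open_nbhs_nbhs; have [] := WP j.
have : \forall y \near x, U (h y) /\ forall j, W j y by apply: filterS2 nU nW.
move=> /near_open [B [oB Bx] BP].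
exists B; first by [].
move=> k; apply: (@Ck_on_comp R n k U B f h oU oB) => //.
  by move=> y /BP [].
move=> j; have [_ /(_ k)] := WP j; apply: Ck_on_subset.
by move=> y /BP [_ /(_ j)].
Qed.

Lemma smooth_near_schwarz x f v w : smooth_near x f ->
  'D_w ('D_v f) x = 'D_v ('D_w f) x.
Proof.
move=> [U [oU Ux] CU]; have D1 u : Ck_on 1 U ('D_u f) by exact: Ck_on_derive.
have D2 u u' : {for x, continuous ('D_u ('D_u' f))}.
  apply: (@Ck_on_continuous _ _ 0%N U) => //.
  by apply: Ck_on_derive.
apply: (@schwarz _ _ U) => // y Uy.
by split; apply: diff_derivable; apply: (@Ck_on_differentiable _ _ 0%N U).
Qed.

End SmoothNear.

(** * Smooth functions and vector fields in charts *)

Local Notation coord := Defs.coord.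

Section Charts.
Variables (R : realType) (n : nat) (N : topologicalType) (M : manifold R n N).
Local Notation V := 'rV[R]_n.
Implicit Types (p q r s : N) (f g : N -> R) (X Y Z : N -> V) (v w : V).

Lemma near_cdom p q : cdom M p q -> \forall r \near q, cdom M p r.
Proof. by move=> pq; apply: open_nbhs_nbhs; split => //; exact: cdom_open. Qed.

Lemma near_chart p q (P : V -> Prop) : cdom M p q ->
  (\forall y \near chart M p q, P y) -> \forall r \near q, P (chart M p r).
Proof. by move=> pq; apply: chart_continuous. Qed.

Lemma near_ichart p q (P : N -> Prop) : cdom M p q ->
  (\forall r \near q, P r) -> \forall y \near chart M p q, P (ichart M p y).
Proof.
move=> pq H; have := @ichart_continuous _ _ _ M p q pq.
by rewrite /prop_for /continuous_at (chartK pq) => /(_ P H).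
Qed.

Lemma near_ichartK p q : cdom M p q ->
  \forall y \near chart M p q, chart M p (ichart M p y) = y.
Proof.
move=> pq; have : \forall y \near chart M p q, (chart M p @` cdom M p) y.
  by apply: open_nbhs_nbhs; split; [exact: cimg_open|exists q].
by apply: filterS => y [r pr <-]; rewrite chartK.
Qed.

(** In the second chart [f] is its expression in the first one composed with
    the transition map. *)
Lemma smooth_near_transition p q s f : cdom M p s -> cdom M q s ->
  smooth_near (chart M p s) (f \o ichart M p) ->
  smooth_near (chart M q s) (f \o ichart M q).
Proof.
move=> ps qs sf.
have st : smooth_near (chart M q s) ((f \o ichart M p)
  \o (chart M p \o ichart M q)).
  apply: smooth_near_comp; first by move=> j; exact: transition_smooth.
  by rewrite /= chartK.
apply: smooth_near_eq st; have := near_ichart qs (near_cdom ps).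
by apply: filterS => y /= h; rewrite chartK.
Qed.

(** Smoothness at [q] is defined in the chart attached to [q]; near a point [p]
    the chart around [p] serves for all [q] at once. *)
Lemma smooth_at_chart p q f : cdom M p q ->
  smooth_at M q f <-> smooth_near (chart M p q) (f \o ichart M p).
Proof. by move=> pq; split; apply: smooth_near_transition => //;
  exact: cdom_refl. Qed.

Lemma smooth_at_nbhs p f : smooth_at M p f ->
  \forall q \near p, smooth_at M q f.
Proof.
move=> /smooth_near_nbhs /(near_chart (cdom_refl M p)).
apply: filterS2 (near_cdom (cdom_refl M p)) => q pq.
by rewrite (smooth_at_chart _ pq).
Qed.

Lemma smooth_at_eq p f g : (\forall q \near p, f q = g q) ->
  smooth_at M p f -> smooth_at M p g.
Proof. by move=> /(near_ichart (cdom_refl M p)); exact: smooth_near_eq. Qed.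

Lemma smooth_atD p f g : smooth_at M p f -> smooth_at M p g ->
  smooth_at M p (fun q => f q + g q).
Proof. exact: smooth_nearD. Qed.

Lemma smooth_atM p f g : smooth_at M p f -> smooth_at M p g ->
  smooth_at M p (fun q => f q * g q).
Proof. exact: smooth_nearM. Qed.

Lemma smooth_at_cst p (c : R) : smooth_at M p (fun=> c).
Proof. exact: smooth_near_cst. Qed.

Lemma smooth_at_sum p (I : finType) (F : I -> N -> R) :
  (forall i, smooth_at M p (F i)) -> smooth_at M p (fun q => \sum_i F i q).
Proof. exact: smooth_near_sum. Qed.

Lemma smooth_at_expR p f : smooth_at M p f ->
  smooth_at M p (fun q => expR (f q)).
Proof. exact: smooth_near_expR. Qed.

Lemma smooth_at_coord p q j : cdom M p q -> smooth_at M q (coord M p j).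
Proof.
move=> pq; apply: transition_smooth => //; exact: cdom_refl.
Qed.

Lemma smooth_at_chart_derive p q f v : cdom M p q -> smooth_at M q f ->
  smooth_at M q (fun r => 'D_v (f \o ichart M p) (chart M p r)).
Proof.
move=> pq sf; apply/(smooth_at_chart _ pq).
apply: smooth_near_eq (smooth_near_derive v ((smooth_at_chart _ pq).1 sf)).
by apply: filterS (near_ichartK pq) => y /= ->.
Qed.

Lemma dirder_eq p v f g : (\forall q \near p, f q = g q) ->
  dirder M p v f = dirder M p v g.
Proof. by move=> /(near_ichart (cdom_refl M p)); exact: near_eq_derive. Qed.

Lemma dirder_linear p f : smooth_at M p f ->
  linear_form (fun v => dirder M p v f).
Proof.
move=> /smooth_near_differentiable df a v w; rewrite /dirder !(deriveE _ df).
by rewrite linearP.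
Qed.

Lemma dirder_cst p v (c : R) : dirder M p v (fun=> c) = 0.
Proof. exact: derive_cst. Qed.

Lemma dirderD p v f g : smooth_at M p f -> smooth_at M p g ->
  dirder M p v (fun q => f q + g q) = dirder M p v f + dirder M p v g.
Proof.
move=> /smooth_near_differentiable df /smooth_near_differentiable dg.
have := deriveD (diff_derivable (v:=v) df) (diff_derivable (v:=v) dg).
by move=> <-; congr (derive _ _ _).
Qed.

Lemma dirderM p v f g : smooth_at M p f -> smooth_at M p g ->
  dirder M p v (fun q => f q * g q) =
    f p * dirder M p v g + g p * dirder M p v f.
Proof.
move=> /smooth_near_differentiable df /smooth_near_differentiable dg.
rewrite /dirder; have := deriveM (diff_derivable (v:=v) df)
  (diff_derivable (v:=v) dg).
rewrite /= chartK; last exact: cdom_refl.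
by move=> <-; congr (derive _ _ _).
Qed.

Lemma dirder_sum p v (I : finType) (F : I -> N -> R) :
  (forall i, smooth_at M p (F i)) ->
  dirder M p v (fun q => \sum_i F i q) = \sum_i dirder M p v (F i).
Proof.
move=> sF.
suff [_] : smooth_at M p (\sum_i F i) /\
   dirder M p v (\sum_i F i) = \sum_i dirder M p v (F i).
  by move=> <-; congr dirder; apply/funext => q; rewrite fct_sumE.
elim/big_ind2: _ => [|f1 x1 f2 x2 [s1 e1] [s2 e2]|i _].
- by split; [exact: smooth_at_cst|exact: dirder_cst].
- by split; [exact: smooth_atD|rewrite -e1 -e2; exact: dirderD].
- by split.
Qed.

Lemma dirder_expR p v f : smooth_at M p f ->
  dirder M p v (fun q => expR (f q)) = expR (f p) * dirder M p v f.
Proof.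
move=> /smooth_near_differentiable df.
have := derive_expR_comp v df.
by rewrite /= chartK //; exact: cdom_refl.
Qed.

(** [dirder M q] is computed in a chart that varies with [q].  In the fixed chart
    around [p] it becomes an expression that can be differentiated in [q]. *)
Lemma dirder_chart p q f v : cdom M p q -> smooth_at M q f ->
  dirder M q v f =
  'D_(\row_j dirder M q v (coord M p j)) (f \o ichart M p) (chart M p q).
Proof.
move=> pq sf; have qq := cdom_refl M q.
have -> : dirder M q v f =
    'D_v ((f \o ichart M p) \o (chart M p \o ichart M q)) (chart M q q).
  apply: near_eq_derive; have := near_ichart qq (near_cdom pq).
  by apply: filterS => y /= h; rewrite chartK.
rewrite derive_comp_row.
- by rewrite /= chartK.
- move=> j; apply: smooth_near_differentiable; exact: transition_smooth.
- by rewrite /= chartK //; apply/smooth_near_differentiable/smooth_at_chart.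
Qed.

Lemma dirder_chart_sum p q f v : cdom M p q -> smooth_at M q f ->
  dirder M q v f = \sum_j dirder M q v (coord M p j) *
    'D_(basis_vec R j) (f \o ichart M p) (chart M p q).
Proof.
move=> pq sf; rewrite (dirder_chart _ pq sf) derive_basis.
  by apply: eq_bigr => j _; rewrite mxE.
exact/smooth_near_differentiable/smooth_at_chart.
Qed.

(** Constant fields of a chart act on functions as directional derivatives in
    that chart, at every point of its domain. *)
Lemma dirder_const_field p q f v : cdom M p q -> smooth_at M q f ->
  dirder M q (const_field M p v q) f = 'D_v (f \o ichart M p) (chart M p q).
Proof.
move=> pq sf; have qq := cdom_refl M q.
have -> : 'D_v (f \o ichart M p) (chart M p q) =
    'D_v ((f \o ichart M q) \o (chart M q \o ichart M p)) (chart M p q).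
  apply: near_eq_derive; have := near_ichart pq (near_cdom qq).
  by apply: filterS => y /= h; rewrite chartK.
rewrite derive_comp_row.
- by rewrite /= chartK.
- move=> j; apply: smooth_near_differentiable; exact: transition_smooth.
- by rewrite /= chartK //; exact: smooth_near_differentiable sf.
Qed.

Lemma derive_coordinate p q v j : cdom M p q ->
  'D_v (coord M p j \o ichart M p) (chart M p q) = v 0 j.
Proof.
move=> pq; have -> : 'D_v (coord M p j \o ichart M p) (chart M p q) =
    'D_v (fun x : V => x 0 j) (chart M p q).
  by apply: near_eq_derive; apply: filterS (near_ichartK pq) => y /= h;
    rewrite /Defs.coord h.
have := @derive_mx R _ 1 n (fun x : V => x) (chart M p q) v.
move=> /(_ (@derivable_id _ _ _ _)) /matrixP /(_ 0 j); rewrite mxE => <-.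
by rewrite derive_id.
Qed.

Lemma const_field_self p v : const_field M p v p = v.
Proof. by apply/rowP => j; rewrite mxE derive_coordinate //; exact: cdom_refl. Qed.

Lemma vf_comp_const_field p q v j : cdom M p q ->
  vf_comp M p (const_field M p v) j q = v 0 j.
Proof.
move=> pq; rewrite /vf_comp dirder_const_field //; last exact: smooth_at_coord.
exact: derive_coordinate.
Qed.

Lemma vf_comp_self p X j : vf_comp M p X j p = X p 0 j.
Proof. exact/derive_coordinate/cdom_refl. Qed.

(** By the chain rule the new components are combinations of the old ones
    with the entries of the Jacobian matrix of the transition map. *)
Lemma smooth_vf_comp_transition p s q X : cdom M p q -> cdom M s q ->
  (forall j, smooth_at M q (vf_comp M p X j)) ->
  forall j, smooth_at M q (vf_comp M s X j).
Proof.
move=> pq sq sX j.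
have : smooth_at M q (fun r => \sum_i vf_comp M p X i r *
    'D_(basis_vec R i) (coord M s j \o ichart M p) (chart M p r)).
  apply: smooth_at_sum => i; apply: smooth_atM; first exact: sX.
  by apply: smooth_at_chart_derive => //; exact: smooth_at_coord.
apply: smooth_at_eq; apply: filterS2 (near_cdom pq) (near_cdom sq) => r pr sr.
by rewrite /vf_comp [RHS](dirder_chart_sum _ pr) //; exact: smooth_at_coord.
Qed.

Lemma smooth_vf_at_chart p q X : cdom M p q ->
  smooth_vf_at M q X <-> forall j, smooth_at M q (vf_comp M p X j).
Proof.
by move=> pq; split; apply: smooth_vf_comp_transition => //; exact: cdom_refl.
Qed.

Lemma smooth_vf_at_eq p X Y : (\forall q \near p, X q = Y q) ->
  smooth_vf_at M p X -> smooth_vf_at M p Y.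
Proof.
move=> XY sX j; apply: smooth_at_eq (sX j).
by apply: filterS XY => q; rewrite /vf_comp => ->.
Qed.

Lemma smooth_const_field p q v : cdom M p q ->
  smooth_vf_at M q (const_field M p v).
Proof.
move=> pq; apply/(smooth_vf_at_chart _ pq) => j.
apply: smooth_at_eq (smooth_at_cst q (v 0 j)).
by apply: filterS (near_cdom pq) => r pr; rewrite vf_comp_const_field.
Qed.

Lemma smooth_vf_at_linear p f X Y : smooth_at M p f ->
  smooth_vf_at M p X -> smooth_vf_at M p Y ->
  smooth_vf_at M p (fun q => f q *: X q + Y q).
Proof.
move=> sf sX sY j.
have : smooth_at M p (fun q => f q * vf_comp M p X j q + vf_comp M p Y j q).
  by apply: smooth_atD => //; apply: smooth_atM.
apply: smooth_at_eq; apply: filterS (near_cdom (cdom_refl M p)) => q pq.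
by rewrite /vf_comp dirder_linear //; exact: smooth_at_coord.
Qed.

Lemma smooth_vf_at0 p : smooth_vf_at M p (fun=> 0).
Proof.
move=> j; apply: smooth_at_eq (smooth_at_cst p 0).
by apply: nearW => q; rewrite /vf_comp /dirder derive0.
Qed.

Lemma smooth_vf_atZ p f X : smooth_at M p f -> smooth_vf_at M p X ->
  smooth_vf_at M p (fun q => f q *: X q).
Proof.
move=> sf sX; have := smooth_vf_at_linear sf sX (@smooth_vf_at0 p).
by apply: smooth_vf_at_eq; apply: nearW => q; rewrite addr0.
Qed.

(** The coordinate fields form a frame over the whole chart domain: this is the
    chain rule for the coordinates of the chart attached to [q]. *)
Lemma vf_decomposition p q X : cdom M p q ->
  X q = \sum_j vf_comp M p X j q *: const_field M p (basis_vec R j) q.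
Proof.
move=> pq; have qq := cdom_refl M q; apply/rowP => i.
rewrite -vf_comp_self /vf_comp (dirder_chart_sum _ pq); last exact: smooth_at_coord.
by rewrite summxE; apply: eq_bigr => j _; rewrite !mxE.
Qed.

Lemma const_field_linear p q (a : R) v w : cdom M p q ->
  const_field M p (a *: v + w) q =
    a *: const_field M p v q + const_field M p w q.
Proof.
move=> pq; apply/rowP => j; rewrite !mxE.
have df : differentiable (coord M q j \o ichart M p) (chart M p q).
  by apply: smooth_near_differentiable; apply: transition_smooth => //;
    exact: cdom_refl.
by rewrite !(deriveE _ df) linearP.
Qed.

(** The components of the bracket are differences of mixed second
    derivatives of the transition map. *)
Lemma bracket_const_field p q v w : cdom M p q ->
  bracket M (const_field M p v) (const_field M p w) q = 0.
Proof.
move=> pq; apply/rowP => j; rewrite !mxE.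
have sc := @smooth_at_coord q q j (cdom_refl M q).
have E u u' : dirder M q (const_field M p u q) (vf_comp M q (const_field M p u') j)
    = 'D_u ('D_u' (coord M q j \o ichart M p)) (chart M p q).
  rewrite (dirder_const_field u pq (smooth_const_field u' pq j)).
  apply: near_eq_derive.
  apply: filterS3 (near_ichart pq (smooth_at_nbhs sc))
    (near_ichart pq (near_cdom pq)) (near_ichartK pq).
  by move=> y /= sy py yE; rewrite /vf_comp dirder_const_field // yE.
rewrite !E; apply/eqP; rewrite subr_eq0; apply/eqP.
by apply: smooth_near_schwarz; apply/smooth_at_chart.
Qed.

Lemma dirder_const_field_comm p q v w f : cdom M p q -> smooth_at M q f ->
  dirder M q (const_field M p v q)
    (fun r => dirder M r (const_field M p w r) f) =
  dirder M q (const_field M p w q)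
    (fun r => dirder M r (const_field M p v r) f).
Proof.
move=> pq sf.
have E u u' : dirder M q (const_field M p u q)
      (fun r => dirder M r (const_field M p u' r) f)
    = 'D_u ('D_u' (f \o ichart M p)) (chart M p q).
  have near1 : \forall r \near q, dirder M r (const_field M p u' r) f =
      'D_u' (f \o ichart M p) (chart M p r).
    apply: filterS2 (near_cdom pq) (smooth_at_nbhs sf) => r pr sr.
    exact: dirder_const_field.
  rewrite (dirder_eq _ near1) (dirder_const_field u pq (smooth_at_chart_derive
    u' pq sf)).
  by apply: near_eq_derive; apply: filterS (near_ichartK pq) => y /= ->.
by rewrite !E; apply: smooth_near_schwarz; apply/smooth_at_chart.
Qed.

End Charts.

(** * Curvature of a Weyl connection *)

Local Opaque const_field.

Section LinearForm.
Variables (R : realType) (n : nat) (f : 'rV[R]_n -> R).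
Hypothesis lf : linear_form f.

Lemma linear_formD x y : f (x + y) = f x + f y.
Proof. by have := lf 1 x y; rewrite scale1r mul1r. Qed.

Lemma linear_form0 : f 0 = 0.
Proof. by apply: (addrI (f 0)); rewrite -linear_formD !addr0. Qed.

Lemma linear_formZ a x : f (a *: x) = a * f x.
Proof. by have := lf a x 0; rewrite addr0 linear_form0 addr0. Qed.

Lemma linear_formB x y : f (x - y) = f x - f y.
Proof. by rewrite linear_formD -scaleN1r linear_formZ mulN1r. Qed.

Lemma linear_form_sum (I : finType) (F : I -> 'rV[R]_n) :
  f (\sum_i F i) = \sum_i f (F i).
Proof. exact: (big_morph f linear_formD linear_form0). Qed.

Lemma linear_form_basis x : f x = \sum_i x 0 i * f (basis_vec R i).
Proof.
rewrite {1}(row_sum_basis x) linear_form_sum.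
by apply: eq_bigr => i _; rewrite linear_formZ.
Qed.

End LinearForm.

Section Connection.
Variables (R : realType) (n : nat) (N : topologicalType) (M : manifold R n N).
Variable D : connection M.
Local Notation V := 'rV[R]_n.
Implicit Types (p q r : N) (X Y Z : N -> V) (v w x y z : V) (a : R).

(** Multiply both fields by the indicator function of an open set on which they
    agree.  The products are equal everywhere, and the indicator function is
    locally constant, so the Leibniz rule does not see it at [p]. *)
Lemma conn_eq p Y Z v : (\forall q \near p, Y q = Z q) -> smooth_vf_at M p Y ->
  D Y p v = D Z p v.
Proof.
move=> YZ sY; have sZ := smooth_vf_at_eq YZ sY.
have [B Bp BYZ] := near_open YZ.
pose f q : R := if `[< B q >] then 1 else 0.
have f1 : \forall q \near p, 1 = f q.
  have : \forall q \near p, B q by apply: open_nbhs_nbhs.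
  by apply: filterS => q Bq; rewrite /f asboolT.
have sf : smooth_at M p f := smooth_at_eq f1 (smooth_at_cst M p 1).
have df : dirder M p v f = 0 by rewrite -(dirder_eq M v f1) dirder_cst.
have E W : smooth_vf_at M p W -> D W p v = D (fun q => f q *: W q) p v.
  move=> sW; rewrite conn_leibniz // df scale0r add0r.
  by rewrite -(nbhs_singleton f1) scale1r.
rewrite (E _ sY) (E _ sZ); congr (D _ p v); apply/funext => q.
rewrite /f; case: ifPn => [/asboolP /BYZ -> //|_]; by rewrite !scale0r.
Qed.

Lemma conn0 Y p : smooth_vf_at M p Y -> D Y p 0 = 0.
Proof.
move=> sY; have := conn_linear D sY 1 0 0; rewrite !scale1r addr0 => E.
by apply: (addrI (D Y p 0)); rewrite -E addr0.
Qed.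

Lemma conn_field_linear Y Z p v a : smooth_vf_at M p Y -> smooth_vf_at M p Z ->
  D (fun q => a *: Y q + Z q) p v = a *: D Y p v + D Z p v.
Proof.
move=> sY sZ; have sa := smooth_at_cst M p a.
rewrite (conn_add D v (smooth_vf_atZ sa sY) sZ).
by rewrite (conn_leibniz D v sa sY) dirder_cst scale0r add0r.
Qed.

Variable p : N.
Local Notation c := (const_field M p).
Local Notation pp := (cdom_refl M p).

Lemma smooth_nabla_const y z : smooth_vf_at M p (nabla D (c y) (c z)).
Proof. by apply: conn_smooth; exact: smooth_const_field pp. Qed.

(** Iterated covariant derivatives of coordinate fields; the curvature is their
    skew part in the first two arguments, because the brackets vanish. *)
Definition nabla2 x y z : V := D (nabla D (c y) (c z)) p x.

Lemma curv_op_nabla2 x y z :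
  curv_op D (c x) (c y) (c z) p = nabla2 x y z - nabla2 y x z.
Proof.
rewrite /curv_op /nabla (bracket_const_field _ _ pp) conn0;
  last exact: smooth_const_field pp.
by rewrite subr0 !const_field_self.
Qed.

Lemma nabla_nabla2 x y z : nabla D (c x) (nabla D (c y) (c z)) p = nabla2 x y z.
Proof. by rewrite /nabla const_field_self. Qed.

Lemma nabla2_linear1 y z a x x' :
  nabla2 (a *: x + x') y z = a *: nabla2 x y z + nabla2 x' y z.
Proof. exact/conn_linear/smooth_nabla_const. Qed.

Lemma nabla2_linear2 x z a y y' :
  nabla2 x (a *: y + y') z = a *: nabla2 x y z + nabla2 x y' z.
Proof.
rewrite /nabla2 -conn_field_linear; try exact: smooth_nabla_const.
apply: conn_eq; last exact: smooth_nabla_const.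
apply: filterS (near_cdom pp) => q pq; rewrite /nabla const_field_linear //.
exact/conn_linear/(smooth_const_field _ pq).
Qed.

Lemma nabla2_linear3 x y a z z' :
  nabla2 x y (a *: z + z') = a *: nabla2 x y z + nabla2 x y z'.
Proof.
rewrite /nabla2 -conn_field_linear; try exact: smooth_nabla_const.
apply: conn_eq; last exact: smooth_nabla_const.
apply: filterS (near_cdom pp) => q pq; rewrite /nabla.
rewrite -conn_field_linear; try exact: smooth_const_field pq.
apply: conn_eq; last exact: smooth_const_field pq.
by apply: filterS (near_cdom pq) => r pr; rewrite const_field_linear.
Qed.

(** Without torsion [nabla_Y Z - nabla_Z Y] is the bracket, which vanishes on the
    whole chart domain and not only at [p]; so both fields have the same
    covariant derivatives at [p]. *)
Lemma nabla2_sym x y z : torsion_free D -> nabla2 x y z = nabla2 x z y.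
Proof.
move=> tf; apply: conn_eq; last exact: smooth_nabla_const.
apply: filterS (near_cdom pp) => q pq; apply/eqP; rewrite -subr_eq0 tf.
- by rewrite bracket_const_field.
- exact: smooth_const_field pq.
- exact: smooth_const_field pq.
Qed.

End Connection.

Section Metric.
Variables (R : realType) (n : nat) (N : topologicalType) (M : manifold R n N).
Variables (g : metric M) (D : connection M).
Local Notation V := 'rV[R]_n.
Implicit Types (p q r : N) (X Y Z : N -> V) (v w x y z : V) (a : R).

Lemma metric_linear_l p w : linear_form (fun v => g p v w).
Proof. by have [+ _] := metric_bilinear g p; apply. Qed.

Lemma metric_linear_r p v : linear_form (g p v).
Proof. by have [_] := metric_bilinear g p; apply. Qed.

Lemma curvature_nabla2 p x y z w : curvature g D p x y z w =
  g p (nabla2 D p x y z) w - g p (nabla2 D p y x z) w.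
Proof.
by rewrite /curvature curv_op_nabla2 (linear_formB (metric_linear_l _ _)).
Qed.

Local Opaque nabla2 dirder nabla.

Lemma curvature_multilinear p : multilinear4 (curvature g D p).
Proof.
split=> [y z w|x z w|x y w|x y z] a u u'; rewrite !curvature_nabla2.
- by rewrite nabla2_linear1 nabla2_linear2 !metric_linear_l mulrBr opprD addrACA.
- by rewrite nabla2_linear1 nabla2_linear2 !metric_linear_l mulrBr opprD addrACA.
- by rewrite !nabla2_linear3 !metric_linear_l mulrBr opprD addrACA.
- by rewrite !metric_linear_r mulrBr opprD addrACA.
Qed.

Lemma curvature_skew p x y z w :
  curvature g D p x y z w = - curvature g D p y x z w.
Proof. by rewrite !curvature_nabla2 opprB. Qed.

(** In terms of [nabla2] the six summands cancel in pairs by [nabla2_sym]. *)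
Lemma curvature_bianchi p x y z w : torsion_free D ->
  curvature g D p x y z w + curvature g D p y z x w
    + curvature g D p z x y w = 0.
Proof.
move=> tf; rewrite !curvature_nabla2.
rewrite (nabla2_sym p x z y tf) (nabla2_sym p y x z tf) (nabla2_sym p z y x tf).
ring.
Qed.

Variable phi : one_form M.
Hypothesis weyl_phi : weyl_form g D phi.

Lemma dirder_metric p X Y Z : smooth_vf_at M p X -> smooth_vf_at M p Y ->
  smooth_vf_at M p Z ->
  dirder M p (X p) (fun q => g q (Y q) (Z q)) =
  g p (nabla D X Y p) (Z p) + g p (Y p) (nabla D X Z p)
  - 2%:R * phi p (X p) * g p (Y p) (Z p).
Proof.
move=> sX sY sZ; have := weyl_phi sX sY sZ; rewrite /nabla_metric => E.
by rewrite -mulrA -mulNr mulrA -E; ring.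
Qed.

(** Both orders of differentiating [g(Z, W)] along the coordinate fields [x] and
    [y] agree.  Each order produces the second covariant derivatives of [Z] and
    [W], the derivative of [phi], and products of first-order terms. *)
Lemma curvature_weyl p x y z w :
  curvature g D p x y z w + curvature g D p x y w z =
  2%:R * ext_der phi (const_field M p x) (const_field M p y) p * g p z w.
Proof.
have pp := cdom_refl M p.
set c := const_field M p.
have sc u q : cdom M p q -> smooth_vf_at M q (c u) by exact: smooth_const_field.
have scp u : smooth_vf_at M p (c u) by exact: sc.
have sn u u' : smooth_vf_at M p (nabla D (c u) (c u')) by exact: smooth_nabla_const.
have cE u : c u p = u by exact: const_field_self.
pose F q := g q (c z q) (c w q).
have sF : smooth_at M p F by exact: metric_smooth.
have sphi u : smooth_at M p (fun q => phi q (c u q)) by exact: one_form_smooth.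
have dF u q : cdom M p q -> dirder M q (c u q) F =
    g q (nabla D (c u) (c z) q) (c w q) + g q (c z q) (nabla D (c u) (c w) q)
    - 2%:R * phi q (c u q) * F q.
  by move=> pq; apply: dirder_metric; exact: sc.
(* The first-order terms of [ddF] below; they cancel in the difference of the
   two orders because they are symmetric in the two directions. *)
pose S u u' := g p (nabla D (c u') (c z) p) (nabla D (c u) (c w) p)
  + g p (nabla D (c u) (c z) p) (nabla D (c u') (c w) p)
  - 2%:R * phi p u * (g p (nabla D (c u') (c z) p) w
      + g p z (nabla D (c u') (c w) p))
  - 2%:R * phi p u' * (g p (nabla D (c u) (c z) p) w
      + g p z (nabla D (c u) (c w) p))
  + 2%:R * phi p u * (2%:R * phi p u') * g p z w.
have ddF u u' : dirder M p (c u p) (fun q => dirder M q (c u' q) F) =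
   g p (nabla2 D p u u' z) w + g p z (nabla2 D p u u' w) + S u u'
   - 2%:R * dirder M p (c u p) (fun q => phi q (c u' q)) * g p z w.
  have E : \forall q \near p,
    g q (nabla D (c u') (c z) q) (c w q) + g q (c z q) (nabla D (c u') (c w) q)
    + (- 2%:R) * (phi q (c u' q) * F q) = dirder M q (c u' q) F.
    by apply: filterS (near_cdom pp) => q pq; rewrite (dF u' q pq) mulNr mulrA.
  have s1 : smooth_at M p (fun q => g q (nabla D (c u') (c z) q) (c w q)).
    exact: metric_smooth.
  have s2 : smooth_at M p (fun q => g q (c z q) (nabla D (c u') (c w) q)).
    exact: metric_smooth.
  have s3 : smooth_at M p (fun q => phi q (c u' q) * F q) :=
    smooth_atM (sphi u') sF.
  have s4 := smooth_at_cst M p (- 2%:R : R).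
  rewrite -(dirder_eq M _ E).
  rewrite (dirderD _ (smooth_atD s1 s2) (smooth_atM s4 s3)) (dirderD _ s1 s2).
  rewrite (dirderM _ s4 s3) dirder_cst mulr0 addr0 (dirderM _ (sphi u') sF).
  rewrite (dF u p pp).
  rewrite (dirder_metric (scp u) (sn u' z) (scp w)).
  rewrite (dirder_metric (scp u) (scp z) (sn u' w)).
  rewrite mulNr /F !cE.
  rewrite (nabla_nabla2 D p u u' z) (nabla_nabla2 D p u u' w) /S.
  ring.
have Ssym u u' : S u u' = S u' u by rewrite /S; ring.
have := dirder_const_field_comm x y pp sF; rewrite -/c !ddF (Ssym y x) => E.
rewrite /ext_der -/c (bracket_const_field _ _ pp)
  (linear_form0 (one_form_linear phi p)).
rewrite !curvature_nabla2 (Defs.metric_sym g p (nabla2 _ _ x y w)).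
rewrite (Defs.metric_sym g p (nabla2 _ _ y x w)).
move: E; set G := g p z w; set d1 := dirder _ _ _ _; set d2 := dirder _ _ _ _.
lra.
Qed.

End Metric.

(** * Closed Weyl forms give trivial Weyl structures *)

Section Trivial.
Variables (R : realType) (n : nat) (N : topologicalType) (M : manifold R n N).
Local Notation V := 'rV[R]_n.
Implicit Types (p q r : N) (X Y Z : N -> V) (v w x y z : V) (a : R).

Lemma one_form_field (phi : one_form M) p X q : cdom M p q ->
  phi q (X q) =
    \sum_j vf_comp M p X j q * phi q (const_field M p (basis_vec R j) q).
Proof.
move=> pq; rewrite {1}(vf_decomposition X pq).
rewrite (linear_form_sum (one_form_linear phi q)); apply: eq_bigr => j _.
by rewrite (linear_formZ (one_form_linear phi q)).
Qed.

Lemma dirder_basis p v f : smooth_at M p f ->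
  dirder M p v f = \sum_i v 0 i * dirder M p (basis_vec R i) f.
Proof. by move=> sf; apply: (linear_form_basis (dirder_linear sf)). Qed.

(** In the frame of coordinate fields the derivatives of the components of [X]
    and [Y] cancel against [phi] of the bracket. *)
Lemma ext_der_tensorial (phi : one_form M) p X Y :
  smooth_vf_at M p X -> smooth_vf_at M p Y ->
  ext_der phi X Y p = \sum_i \sum_j X p 0 i * Y p 0 j *
    ext_der phi (const_field M p (basis_vec R i))
      (const_field M p (basis_vec R j)) p.
Proof.
move=> sX sY; have pp := cdom_refl M p.
pose c j := const_field M p (basis_vec R j).
pose h j q := phi q (c j q).
have sh j : smooth_at M p (h j) by apply: one_form_smooth;
  exact: smooth_const_field.
have dphi Z W : smooth_vf_at M p W ->
    dirder M p (Z p) (fun q => phi q (W q)) =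
    \sum_j (W p 0 j * dirder M p (Z p) (h j) + h j p * dirder M p (Z p)
      (vf_comp M p W j)).
  move=> sW; have E : \forall q \near p, phi q (W q) =
    \sum_j vf_comp M p W j q * h j q.
    by apply: filterS (near_cdom pp) => q; exact: one_form_field.
  rewrite (dirder_eq M _ E) dirder_sum; last by move=> j; exact: smooth_atM.
  apply: eq_bigr => j _; rewrite (dirderM _ (sW j) (sh j)).
  by rewrite vf_comp_self.
have phib : phi p (bracket M X Y p) = \sum_j h j p *
    (dirder M p (X p) (vf_comp M p Y j) - dirder M p (Y p) (vf_comp M p X j)).
  rewrite (linear_form_basis (one_form_linear phi p)); apply: eq_bigr => j _.
  by rewrite mxE /h /c const_field_self mulrC.
have ec i j : ext_der phi (c i) (c j) p =
    dirder M p (basis_vec R i) (h j) - dirder M p (basis_vec R j) (h i).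
  rewrite /ext_der (bracket_const_field _ _ pp)
    (linear_form0 (one_form_linear phi p)) subr0.
  by rewrite /c !const_field_self.
rewrite {1}/ext_der (dphi X Y sY) (dphi Y X sX) phib -!sumrB.
(* The derivatives of the components drop out here. *)
transitivity (\sum_j (Y p 0 j * dirder M p (X p) (h j)
  - X p 0 j * dirder M p (Y p) (h j))).
  apply: eq_bigr => j _.
  move: (dirder M p (X p) (vf_comp M p Y j)) (dirder M p (Y p)
    (vf_comp M p X j)) => A B.
  move: (dirder M p _ _) (dirder M p _ _) => A' B'; ring.
under [RHS]eq_bigr => i _ do under eq_bigr => j _ do rewrite ec mulrBr.
under [RHS]eq_bigr => i _ do rewrite sumrB.
rewrite !sumrB; congr (_ - _).
  rewrite exchange_big; apply: eq_bigr => j _ /=.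
  by rewrite (dirder_basis _ (sh j)) mulr_sumr; apply: eq_bigr => i _;
    rewrite mulrCA mulrA.
apply: eq_bigr => i _.
by rewrite (dirder_basis _ (sh i)) mulr_sumr; apply: eq_bigr => j _; rewrite mulrA.
Qed.

Variables (g : metric M) (D : connection M) (phi : one_form M).

Section Conformal.
Variable f : N -> R.
Hypothesis sf : forall p, smooth_at M p f.

Let scale p : R := expR (2%:R * f p).

Let smooth_scale p : smooth_at M p scale.
Proof. by apply: smooth_at_expR; apply: smooth_atM => //; exact: smooth_at_cst. Qed.

Definition conformal_form p : tensor2 R n := fun x y => scale p * g p x y.

Lemma conformal_bilinear p : bilinear2 (conformal_form p).
Proof.
split=> [y|x] a u v; rewrite /conformal_form.
  by rewrite metric_linear_l; ring.
by rewrite metric_linear_r; ring.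
Qed.

Lemma conformal_sym p x y : conformal_form p x y = conformal_form p y x.
Proof. by rewrite /conformal_form Defs.metric_sym. Qed.

Lemma conformal_nondegenerate p x : (forall y, conformal_form p x y = 0) -> x = 0.
Proof.
move=> h; apply: (metric_nondegenerate (m := g) (p := p)) => y; have /eqP := h y.
by rewrite mulf_eq0 expR_eq0 => /eqP.
Qed.

Lemma conformal_smooth p X Y : smooth_vf_at M p X -> smooth_vf_at M p Y ->
  smooth_at M p (fun q => conformal_form q (X q) (Y q)).
Proof. by move=> sX sY; apply: smooth_atM => //; exact: metric_smooth. Qed.

Definition conformal_metric : metric M :=
  Defs.Metric conformal_bilinear conformal_sym conformal_nondegenerate
    conformal_smooth.

Lemma conformal_conformal_metric : conformal g conformal_metric.
Proof. by exists f. Qed.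

(** The derivative of the factor [exp(2f)] contributes [2 df = 2 phi], which is
    what the Weyl condition subtracts. *)
Lemma conformal_levi_civita : torsion_free D -> weyl_form g D phi ->
  (forall p v, phi p v = dirder M p v f) -> levi_civita conformal_metric D.
Proof.
move=> tf wf phif; split => // p X Y Z sX sY sZ.
have sg := metric_smooth g sY sZ.
rewrite /nabla_metric /= /conformal_form (dirderM _ (smooth_scale p) sg).
rewrite (dirder_metric wf sX sY sZ) dirder_expR; last first.
  by apply: smooth_atM => //; exact: smooth_at_cst.
rewrite (dirderM _ (smooth_at_cst M p _) (sf p)) dirder_cst -phif -/(scale p).
move: (g p (nabla D X Y p) _) (g p (Y p) (nabla D X Z p)) => A B.
move: (scale p) (phi p _) (g p _ _) (f p) => e u v w; ring.
Qed.

End Conformal.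

Lemma closed_weyl_trivial : torsion_free D -> weyl_form g D phi ->
  H1_vanishes M -> closed_form phi -> weyl_trivial g D.
Proof.
move=> tf wf H1 cl; split; first by exists phi.
have [f sf phif] := H1 phi cl.
exists (conformal_metric sf); first exact: conformal_conformal_metric.
exact: conformal_levi_civita.
Qed.

End Trivial.

(** * Curvature tensors at a point *)

Section Pointwise.
Variables (R : realType) (n : nat) (g : tensor2 R n).
Local Notation V := 'rV[R]_n.
Implicit Types (x y z w : V) (s t : tensor2 R n) (A B : tensor4 R n).
Hypothesis bg : bilinear2 g.
Hypothesis sg : forall x y, g x y = g y x.
Hypothesis ng : forall x, (forall y, g x y = 0) -> x = 0.
Local Notation e := (@basis_vec R n).

Lemma gram_unit : gram g \in unitmx.
Proof.
rewrite -row_free_unit; apply: inj_row_free => v vG; apply: ng => y.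
rewrite (linear_form_basis (bg.2 v)) big1 // => j _.
rewrite (_ : g v (e j) = 0) ?mulr0 // (linear_form_basis (bg.1 (e j))).
have /matrixP /(_ 0 j) := vG; rewrite !mxE => E; rewrite -[RHS]E.
by apply: eq_bigr => i _; rewrite !mxE.
Qed.

Lemma gram_ginv i k : \sum_j g (e i) (e j) * ginv g j k = (i == k)%:R.
Proof.
have /matrixP /(_ i k) := mulmxV gram_unit; rewrite !mxE => <-.
by apply: eq_bigr => j _; rewrite mxE.
Qed.

Lemma ginv_sym i j : ginv g i j = ginv g j i.
Proof.
have gT : (gram g)^T = gram g by apply/matrixP => k l; rewrite !mxE sg.
by rewrite /ginv -{1}gT -trmx_inv mxE.
Qed.

Lemma metric_trace_eq s t : (forall x y, s x y = t x y) ->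
  metric_trace g s = metric_trace g t.
Proof. by move=> st; apply: eq_bigr => i _; apply: eq_bigr => j _; rewrite st. Qed.

Lemma metric_traceD s t :
  metric_trace g (fun a b => s a b + t a b) =
    metric_trace g s + metric_trace g t.
Proof.
rewrite -big_split; apply: eq_bigr => i _; rewrite -big_split.
by apply: eq_bigr => j _; rewrite mulrDr.
Qed.

Lemma metric_traceZ (c : R) t :
  metric_trace g (fun a b => c * t a b) = c * metric_trace g t.
Proof.
rewrite mulr_sumr; apply: eq_bigr => i _; rewrite mulr_sumr.
by apply: eq_bigr => j _; rewrite mulrCA.
Qed.

Lemma metric_trace_transpose t :
  metric_trace g (fun a b => t b a) = metric_trace g t.
Proof.
rewrite /metric_trace exchange_big; apply: eq_bigr => i _; apply: eq_bigr => j _.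
by rewrite ginv_sym.
Qed.

Lemma metric_trace_self : metric_trace g g = n%:R.
Proof.
rewrite -[n in RHS]card_ord -sumr_const; apply: eq_bigr => i _.
have := gram_ginv i i; rewrite eqxx mulr1n => <-.
by apply: eq_bigr => j _; rewrite mulrC ginv_sym.
Qed.

(** Raising an index and lowering it again is the identity: the sum over the
    metric index is the product of the Gram matrix with its inverse. *)
Lemma metric_trace_contract (f : V -> R) x : linear_form f ->
  metric_trace g (fun a b => g x a * f b) = f x.
Proof.
move=> lf; rewrite /metric_trace exchange_big (linear_form_basis lf x).
apply: eq_bigr => j _ /=.
transitivity (\sum_i g x (e i) * ginv g i j * f (e j)).
  by apply: eq_bigr => i _; rewrite mulrA [ginv _ _ _ * _]mulrC.
rewrite -mulr_suml; congr (_ * _).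
transitivity (\sum_i \sum_k x 0 k * (g (e k) (e i) * ginv g i j)).
  apply: eq_bigr => i _; rewrite (linear_form_basis (bg.1 (e i)) x) mulr_suml.
  by apply: eq_bigr => k _; rewrite mulrA.
rewrite exchange_big (bigD1 j) //= -mulr_sumr gram_ginv eqxx mulr1 big1 ?addr0 //.
by move=> k kj; rewrite -mulr_sumr gram_ginv (negbTE kj) mulr0.
Qed.

Lemma metric_trace_contract_r (f : V -> R) x : linear_form f ->
  metric_trace g (fun a b => f a * g x b) = f x.
Proof.
move=> lf; rewrite -metric_trace_transpose -[RHS](metric_trace_contract x lf).
by apply: metric_trace_eq => a b; rewrite mulrC.
Qed.

Lemma metric_trace_skew t : (forall x y, t x y = - t y x) -> metric_trace g t = 0.
Proof.
move=> st; have E : metric_trace g t = - metric_trace g t.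
  rewrite -mulN1r -metric_traceZ -[RHS]metric_trace_transpose.
  by apply: metric_trace_eq => x y; rewrite mulN1r -st.
by move: E; move: (metric_trace g t) => u; lra.
Qed.

Lemma metric_trace_symm t : metric_trace g (symm t) = metric_trace g t.
Proof.
rewrite (@metric_trace_eq (symm t) (fun a b => 2%:R^-1 * (t a b + t b a)));
  last first.
  by move=> a b; rewrite mulrC.
by rewrite metric_traceZ metric_traceD metric_trace_transpose; lra.
Qed.

Lemma ricciE A x y : ricci g A x y = metric_trace g (fun a b => A a x y b).
Proof. by []. Qed.

(** Contract the first Bianchi identity over its first and last arguments.  The
    third term becomes a trace in the last two arguments, and only the part of
    [A] symmetric in them, given by [omega], contributes. *)
Lemma ricci_skew_part (omega : tensor2 R n) A x y :
  (forall x y z w, A x y z w = - A y x z w) ->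
  (forall x y z w, A x y z w + A y z x w + A z x y w = 0) ->
  (forall x y z w, A x y z w + A x y w z = 2%:R * omega x y * g z w) ->
  asymm (ricci g A) x y = - (n%:R / 2%:R) * omega x y.
Proof.
move=> sk bi we.
have E1 : metric_trace g (fun a b => A x y a b) = n%:R * omega x y.
  have : metric_trace g (fun a b => A x y a b + A x y b a) =
    2%:R * omega x y * n%:R.
    by rewrite -metric_trace_self -metric_traceZ; apply: metric_trace_eq => a b.
  rewrite metric_traceD (metric_trace_transpose (A x y)).
  by move: (metric_trace _ _) => u; lra.
have E2 : ricci g A y x = ricci g A x y + metric_trace g (fun a b => A x y a b).
  rewrite !ricciE -metric_traceD; apply: metric_trace_eq => a b.
  by have := bi a x y b; rewrite (sk y a x b); lra.
by rewrite /asymm E2 E1; lra.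
Qed.

Lemma weyl_curvature_W_space (omega : tensor2 R n) A : (0 < n)%N ->
  multilinear4 A ->
  (forall x y z w, A x y z w = - A y x z w) ->
  (forall x y z w, A x y z w + A y z x w + A z x y w = 0) ->
  (forall x y z w, A x y z w + A x y w z = 2%:R * omega x y * g z w) ->
  W_space g A.
Proof.
move=> n0 mA sk bi we; split => // x y z w.
rewrite we (ricci_skew_part _ _ sk bi we).
by field; rewrite pnatr_eq0 -lt0n.
Qed.

Lemma ricci_bilinear A : multilinear4 A -> bilinear2 (ricci g A).
Proof.
move=> [_ l2 l3 _]; split=> [y|x] a u v; rewrite !ricciE -metric_traceZ
  -metric_traceD.
  by apply: metric_trace_eq => b c; rewrite l2.
by apply: metric_trace_eq => b c; rewrite l3.
Qed.

Lemma asymm_bilinear t : bilinear2 t -> bilinear2 (asymm t).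
Proof. by move=> [l1 l2]; split=> [y|x] a u v; rewrite /asymm l1 l2; field. Qed.

Lemma symm_bilinear t : bilinear2 t -> bilinear2 (symm t).
Proof. by move=> [l1 l2]; split=> [y|x] a u v; rewrite /symm l1 l2; field. Qed.

Lemma asymmN t x y : asymm t x y = - asymm t y x.
Proof. by rewrite /asymm; field. Qed.

Lemma symmC t x y : symm t x y = symm t y x.
Proof. by rewrite /symm addrC. Qed.

Definition higa_tensor (psi : tensor2 R n) : tensor4 R n := fun x y z w =>
  2%:R * tdot psi g x y z w + wedge_ 1 psi g x y z w.

(** Let [psi] be [-1/n] times the skew part of the Ricci tensor.  Then
    [C = A - (2 psi . g + psi wedge_1 g)] is skew in the last two arguments, so
    its Ricci tensor is symmetric and [C] lies in [A_space g].  Hence the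
    decomposition exists.  When its component in [P_space g] is zero, the other
    component is [A]. *)
Lemma higa_vanishing A : W_space g A ->
  (forall x y z w, higa_component g A x y z w = 0) ->
  forall x y z w, A x y z w + A x y w z = 0.
Proof.
move=> [mA sk bi we] H0.
pose L := asymm (ricci g A).
have bL : bilinear2 L by exact/asymm_bilinear/ricci_bilinear.
have sL x y : L x y = - L y x by exact: asymmN.
pose psi : tensor2 R n := fun x y => - n%:R^-1 * L x y.
pose C := fun x y z w => A x y z w - higa_tensor psi x y z w.
have PE x y z w : higa_tensor psi x y z w = - n%:R^-1 *
   (2%:R * L x y * g z w + L x z * g y w - L y z * g x w - L x w * g y z +
     L y w * g x z).
  by rewrite /higa_tensor /tdot /wedge_ /psi; ring.
have skC x y z w : C x y z w = - C y x z w.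
  by rewrite /C !PE (sk x y) (sL y x); ring.
have skC' x y z w : C x y z w + C x y w z = 0.
  have := we x y z w; rewrite -/L /C !PE (sg w z) => E.
  transitivity ((A x y z w + A x y w z) + 4%:R / n%:R * L x y * g z w);
    first by ring.
  by rewrite E; ring.
have biC x y z w : C x y z w + C y z x w + C z x y w = 0.
  rewrite /C !PE (sL y x) (sL z y) (sL z x) (sg y x) (sg z y) (sg z x).
  have := bi x y z w; move: (A x y z w) (A y z x w) (A z x y w) => a b c E.
  have -> : a = - b - c by rewrite -[RHS](addr0 _) -E; ring.
  ring.
have [l1 l2 l3 l4] := mA; have [L1 L2] := bL; have [g1 g2] := bg.
have mC : multilinear4 C.
  split=> [y z w|x z w|x y w|x y z] a u v; rewrite /C !PE.
  - by rewrite l1 !L1 !g1; ring.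
  - by rewrite l2 L2 !L1 !g1; ring.
  - by rewrite l3 !L2 !g1 !g2; ring.
  - by rewrite l4 !L2 !g2; ring.
have AC : A_space g C.
  split=> //; split=> // x y z w.
  rewrite skC' (@ricci_skew_part (fun _ _ => 0) C) //;
    first by rewrite !mulr0 mul0r.
  by move=> *; rewrite skC' mulr0 mul0r.
have PB : P_space g (higa_tensor psi).
  exists psi; split=> // [|x y]; last by rewrite /psi sL mulrN.
  by split=> [y|x] a u v; rewrite /psi ?L1 ?L2; ring.
have := @xgetPex _ (fun _ _ _ _ => 0) [set B : tensor4 R n | P_space g B /\
       A_space g (fun x y z w => A x y z w - B x y z w)].
move=> /(_ (ex_intro _ (higa_tensor psi) (conj PB AC))) [_ [_ h]] x y z w.
have := h x y z w; rewrite -/(higa_component g A).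
by rewrite !H0 !subr0.
Qed.

(** Solve [p(A) = 0] for [A], add the same equation with the last two arguments
    exchanged, and insert the relation defining [W_space g].  Contracting over
    the second and last arguments leaves a linear relation between [g] and the
    skew and symmetric parts of the Ricci tensor.  Its own skew and symmetric
    parts determine these two; [n <> 2] is what makes the first one vanish. *)
Lemma projectively_flat_algebra A : (3 <= n)%N -> W_space g A ->
  (forall x y z w, projective_curvature g A x y z w = 0) ->
  [/\ forall x y, asymm (ricci g A) x y = 0,
      forall x y, symm (ricci g A) x y =
        metric_trace g (ricci g A) / n%:R * g x y
    & forall x y z w, A x y z w = pi1 g A x y z w].
Proof.
move=> n3 [mA sk bi we] pf.
pose L := asymm (ricci g A); pose S := symm (ricci g A).
have [L1 L2] : bilinear2 L by exact/asymm_bilinear/ricci_bilinear.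
have [S1 S2] : bilinear2 S by exact/symm_bilinear/ricci_bilinear.
have sL x y : L x y = - L y x by exact: asymmN.
pose m : R := n%:R; have m3 : 3%:R <= m by rewrite ler_nat.
have m0 : m != 0 by rewrite gt_eqF //; lra.
have m1 : m - 1 != 0 by rewrite gt_eqF //; lra.
have m2 : m + 1 != 0 by rewrite gt_eqF //; lra.
have AE x y z w : A x y z w = - ((m + 1)^-1 * (2%:R * (L x y * g z w)
    + (L x z * g y w - L y z * g x w))
    + (m - 1)^-1 * (S x z * g y w - S y z * g x w)).
  have := pf x y z w; rewrite /projective_curvature /wedge /wedge_ /tdot -/L
    -/S -/m => E.
  apply/eqP; rewrite -subr_eq0 opprK -[X in _ == X]E; apply/eqP.
  by rewrite mul0r; ring.
(* [a] and [b] are the arguments to be contracted. *)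
pose k1 := - (4%:R / m) + 4%:R / (m + 1).
have E x a z b : 0 = (- k1) * (L x a * g z b) + (- (m + 1)^-1) * (L x z * g a b)
   + (m + 1)^-1 * (L a z * g x b) + (- (m + 1)^-1) * (g z a * L x b)
   + ((m + 1)^-1 * g x z) * L a b
   + (- (m - 1)^-1) * (S x z * g a b)
   + (m - 1)^-1 * (S a z * g x b) + (- (m - 1)^-1) * (g z a * S x b)
   + ((m - 1)^-1 * g x z) * S a b.
  have := we x a z b; rewrite -/L !AE -/m (sg b z) (sg a z) => E.
  rewrite -[LHS](subrr (- (4%:R / m) * L x a * g z b)) -{1}E /k1.
  by field; rewrite m0 m2 m1.
pose tau := metric_trace g (ricci g A).
have trS : metric_trace g S = tau by exact: metric_trace_symm.
have trL : metric_trace g L = 0 by exact: metric_trace_skew.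
pose Q x z := (- k1) * L x z + (- (m + 1)^-1) * (L x z * m)
   + (m + 1)^-1 * L x z + (- (m + 1)^-1) * L x z
   + (- (m - 1)^-1) * (S x z * m) + (m - 1)^-1 * S x z + (- (m - 1)^-1) * S x z
   + ((m - 1)^-1 * g x z) * tau.
have trE x z : Q x z = 0.
  apply: esym; rewrite /Q.
  have <- : metric_trace g (fun _ _ => 0) = 0.
    by apply: metric_trace_skew => *; rewrite oppr0.
  rewrite (metric_trace_eq (fun a b => E x a z b)) !metric_traceD !metric_traceZ.
  rewrite trS trL metric_trace_self !metric_trace_contract //.
  rewrite !metric_trace_contract_r //.
  by rewrite mulr0 addr0.
have L0 x z : L x z = 0.
  have k0 : (4%:R - m ^+ 2) / (m * (m + 1)) != 0.
    by rewrite mulf_neq0 ?invr_neq0 ?mulf_neq0 // lt_eqF //; nra.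
  apply: (mulfI k0); rewrite mulr0.
  (* the part of the relation that is skew in [x] and [z] *)
  transitivity ((Q x z - Q z x) / 2%:R); last by rewrite !trE subrr mul0r.
  have SC : S z x = S x z by exact: symmC.
  by rewrite /Q (sL z x) SC (sg z x) /k1; field; rewrite m0 m2 m1.
have SE x z : S x z = tau / m * g x z.
  have c0 : m / (m - 1) != 0 by rewrite mulf_neq0 ?invr_neq0.
  apply: (mulfI c0); rewrite -[LHS]addr0 -(trE x z) /Q !L0.
  by field; rewrite m0 m2 m1.
split=> // x y z w; rewrite AE !L0 !SE /pi1 /wedge /wedge_ mul0r -/tau -/m.
by field; rewrite m0 m1 m2.
Qed.

End Pointwise.

(** * Triviality of the Weyl structure *)

Lemma closed_form_of_chart_fields (R : realType) (n : nat) (N : topologicalType)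
    (M : manifold R n N) (phi : one_form M) :
  (forall p x y, ext_der phi (const_field M p x) (const_field M p y) p = 0) ->
  closed_form phi.
Proof.
move=> h p X Y sX sY; rewrite ext_der_tensorial //.
by rewrite big1 // => i _; rewrite big1 // => j _; rewrite h mulr0.
Qed.

Lemma metric_neq0 (R : realType) (n : nat) (N : topologicalType)
    (M : manifold R n N) (g : metric M) p :
  (0 < n)%N -> exists x y, g p x y != 0.
Proof.
move=> n0; apply: contrapT => h.
have g0 x y : g p x y = 0.
  by apply/eqP; apply: contrapT => /negP gxy; apply: h; exists x, y.
have := metric_nondegenerate (g0 (basis_vec R (Ordinal n0))).
by move/rowP/(_ (Ordinal n0)); rewrite !mxE !eqxx => /eqP; rewrite oner_eq0.
Qed.

Theorem theorem3p17 (R : realType) (n : nat) (N : topologicalType)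
    (M : manifold R n N) (g : metric M) (D : connection M)
    (n_ge3 : (3 <= n)%N) (weyl_gD : weyl g D) (H1_M : H1_vanishes M) :
  ((forall p x y z w, higa g D p x y z w = 0) -> weyl_trivial g D) /\
  (projectively_flat g D ->
    [/\ forall p x y z w,
          curvature g D p x y z w = pi1 (g p) (curvature g D p) x y z w,
        einstein_weyl g D,
        forall p x y, asymm (Ric g D p) x y = 0
      & weyl_trivial g D]).
Proof.
have n0 : (0 < n)%N by exact: leq_trans n_ge3.
have [tf [phi wf]] := weyl_gD.
have bg p := metric_bilinear g p.
have sg p := @Defs.metric_sym _ _ _ _ g p.
have ng p := @metric_nondegenerate _ _ _ _ g p.
pose dphi p x y := ext_der phi (const_field M p x) (const_field M p y) p.
have sk p := curvature_skew g D p.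
have bi p x y z w := curvature_bianchi g p x y z w tf.
have we p : forall x y z w, curvature g D p x y z w + curvature g D p x y w z =
    2%:R * dphi p x y * g p z w.
  by move=> x y z w; exact: curvature_weyl.
have WR p : W_space (g p) (curvature g D p).
  apply: (weyl_curvature_W_space (bg p) (sg p) (ng p) n0 _ (sk p) (bi p) (we p)).
  exact: curvature_multilinear.
have trivial_of_dphi : (forall p x y, dphi p x y = 0) -> weyl_trivial g D.
  move=> d0; apply: (closed_weyl_trivial tf wf H1_M).
  exact: closed_form_of_chart_fields.
split=> [H0|pf].
  apply: trivial_of_dphi => p x y.
  have [z [w gzw]] := metric_neq0 g p n0.
  have := we p x y z w; rewrite (higa_vanishing (bg p) (sg p) (ng p) (WR p)
    (H0 p)).
  move/esym/eqP; rewrite !mulf_eq0 (negbTE gzw) orbF pnatr_eq0 /=.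
  by move/eqP.
have pfR p := projectively_flat_algebra (bg p) (sg p) (ng p) n_ge3 (WR p) (pf p).
have La p x y : asymm (Ric g D p) x y = 0 by have [] := pfR p.
split=> //.
- by move=> p; have [] := pfR p.
- exists (fun p => metric_trace (g p) (Ric g D p) / n%:R) => p x y.
  by have [_ h _] := pfR p; exact: h.
apply: trivial_of_dphi => p x y.
have := ricci_skew_part (bg p) (sg p) (ng p) x y (sk p) (bi p) (we p).
rewrite [LHS]La => /esym/eqP; rewrite mulf_eq0 oppr_eq0 mulf_eq0 invr_eq0.
by rewrite !pnatr_eq0 -leqn0 leqNgt n0 /= => /eqP.
Qed.
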